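(* Under the setting, assumptions (A1)–(A2) and the algorithm PDAc-L described in the context, the sequence $\{(x_n,y_n)\}$ generated by PDAc-L converges to a saddle point of $\mathcal L$, i.e. to a point of $\Omega$.
   Context: Let $f:\mathbb{R}^p\to(-\infty,+\infty]$ and $g:\mathbb{R}^q\to(-\infty,+\infty]$ be proper closed convex functions; $f^*(y)=\sup_u\{\langle y,u\rangle-f(u)\}$ is the Fenchel conjugate, $\mathrm{dom}(h)=\{x:h(x)<+\infty\}$, and for $\lambda>0$, $\mathrm{Prox}_{\lambda h}(x)=\arg\min_u\{h(u)+\frac{1}{2\lambda}\|u-x\|^2\}$. Let $\Phi:\mathrm{dom}(g)\times\mathrm{dom}(f^* )\to\mathbb{R}$ be continuous and $\mathcal L(x,y)=g(x)+\Phi(x,y)-f^*(y)$. Let $\Omega$ be the set of $(x^\star,y^\star)\in\mathrm{dom}(g)\times\mathrm{dom}(f^* )$ with $-\nabla_x\Phi(x^\star,y^\star)\in\partial g(x^\star)$ and $\nabla_y\Phi(x^\star,y^\star)\in\partial f^*(y^\star)$ (saddle points of $\mathcal L$). Assume: (A1) $\Omega\neq\emptyset$, $\mathrm{dom}(g)\times\mathrm{dom}(f^* )\subseteq\mathrm{dom}(\Phi)$, and $\mathcal L(x^\star,y^\star)$ is finite; (A2) for each $y\in\mathrm{dom}(f^* )$, $\Phi(\cdot,y)$ is convex and differentiable, for each $x\in\mathrm{dom}(g)$, $\Phi(x,\cdot)$ is concave and differentiable, and for all bounded $\mathcal X\subset\mathbb R^q$, $\mathcal Y\subset\mathbb R^p$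 there exist $L_{yy},L_{xx}\ge 0$, $L_{xy}>0$ with $\|\nabla_y\Phi(x,y)-\nabla_y\Phi(x,\tilde y)\|\le L_{yy}\|y-\tilde y\|$ and $\|\nabla_x\Phi(x,y)-\nabla_x\Phi(\tilde x,\tilde y)\|\le L_{xx}\|x-\tilde x\|+L_{xy}\|y-\tilde y\|$ for all $x,\tilde x\in\mathcal X\cap\mathrm{dom}(g)$, $y,\tilde y\in\mathcal Y\cap\mathrm{dom}(f^* )$. Algorithm PDAc-L: choose $\psi\in(1,1+\sqrt3)$, $\xi>0$, $\varphi>1$ with $\omega:=2\psi-\xi-\frac{\psi^3\varphi}{1+\psi}>0$, $\tau_{\max}>0$, $\nu\in(0,1)$, $\mu\in(0,1)$, $\eta\in[0,1)$, an integer $M\ge1$, $\beta>0$, $x_0\in\mathrm{dom}(g)$, $y_0\in\mathrm{dom}(f^* )$, $\tau_0\in(0,\tau_{\max}]$; set $z_0=x_0$, $\delta_0=1$. For $n=1,2,\dots$: (1) $z_n=\frac{\psi-1}{\psi}x_{n-1}+\frac1\psi z_{n-1}$ and $x_n=\mathrm{Prox}_{\tau_{n-1}g}(z_n-\tau_{n-1}\nabla_x\Phi(x_{n-1},y_{n-1}))$. (2) Let $\tau=\min\{\varphi\tau_{n-1},\tau_{\max}\}$; set $\tau_n=\tau\mu^i$ and $y_n=\mathrm{Prox}_{\beta\tau_n f^*}(y_{n-1}+\beta\tau_n\nabla_y\Phi(x_n,y_{n-1}))$, where $i$ is the smallest nonnegative integer such that $\frac{\tau_n\tau_{n-1}}{\xi}\|\theta_n\|^2+2\tau_n\Phi_n^y\le\nu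 r_n+(1-\nu)c_n$, with $\theta_n=\nabla_x\Phi(x_n,y_n)-\nabla_x\Phi(x_{n-1},y_{n-1})$, $\Phi_n^y=\Phi(x_n,y_{n-1})+\langle\nabla_y\Phi(x_n,y_{n-1}),y_n-y_{n-1}\rangle-\Phi(x_n,y_n)$, $r_n=\omega\delta_{n-1}\|x_n-x_{n-1}\|^2+\frac1\beta\|y_n-y_{n-1}\|^2$, $c_n=\frac{\eta}{|\mathcal I_n|}\sum_{i\in\mathcal I_n}r_i$, $\mathcal I_n=\{n-1,n-2,\dots,\max\{n-M,1\}\}$ (the $r_i$ for $i<n$ being the values from earlier iterations; for $n=1$, $\mathcal I_1=\emptyset$ and $c_1:=0$). (3) $\delta_n=\tau_n/\tau_{n-1}$. *)

(* Defs.v *)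
From HB Require Import structures.
From mathcomp Require Import all_boot all_order all_algebra.
From mathcomp Require Import all_classical all_reals all_analysis.
Set Implicit Arguments. Unset Strict Implicit. Unset Printing Implicit Defensive.
Import Order.TTheory GRing.Theory Num.Theory.
Import numFieldNormedType.Exports.
Local Open Scope classical_set_scope.
Local Open Scope ring_scope.

Section Defs.
Context {R : realType}.

Definition dot {n : nat} (u v : 'rV[R]_n) : R := \sum_(i < n) u 0 i * v 0 i.
Definition enorm {n : nat} (u : 'rV[R]_n) : R := Num.sqrt (dot u u).

Definition dom {n : nat} (h : 'rV[R]_n -> \bar R) : set 'rV[R]_n :=
  [set x | (h x < +oo)%E].

Definition proper_fun {n : nat} (h : 'rV[R]_n -> \bar R) : Prop :=
  (forall x, h x != -oo%E) /\ (exists x, h x \is a fin_num).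

Definition convex_efun {n : nat} (h : 'rV[R]_n -> \bar R) : Prop :=
  forall (x1 x2 : 'rV[R]_n) (t : R), 0 <= t <= 1 ->
    (h (t *: x1 + (1 - t) *: x2)%R <= t%:E * h x1 + (1 - t)%:E * h x2)%E.

Definition proper_closed_convex {n : nat} (h : 'rV[R]_n -> \bar R) : Prop :=
  [/\ proper_fun h, lower_semicontinuous h & convex_efun h].

Definition fconj {n : nat} (h : 'rV[R]_n -> \bar R) (y : 'rV[R]_n) : \bar R :=
  ereal_sup (range (fun u : 'rV[R]_n => ((dot y u)%:E - h u)%E)).

Definition is_prox {n : nat} (lam : R) (h : 'rV[R]_n -> \bar R) (x u : 'rV[R]_n)
  : Prop :=
  forall v, (h u + ((enorm (u - x)%R) ^+ 2 / (2 * lam))%:E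
             <= h v + ((enorm (v - x)%R) ^+ 2 / (2 * lam))%:E)%E.

Definition subdiff {n : nat} (h : 'rV[R]_n -> \bar R) (x v : 'rV[R]_n) : Prop :=
  h x \is a fin_num /\ forall z, (h x + (dot v (z - x)%R)%:E <= h z)%E.

Definition has_grad {n : nat} (k : 'rV[R]_n -> R) (x v : 'rV[R]_n) : Prop :=
  forall e : R, 0 < e -> exists2 d : R, 0 < d & forall h : 'rV[R]_n,
    enorm h < d -> `|k (x + h) - k x - dot v h| <= e * enorm h.

Definition saddle_set {p q : nat} (g : 'rV[R]_q -> \bar R) (fs : 'rV[R]_p -> \bar R)
  (gx : 'rV[R]_q -> 'rV[R]_p -> 'rV[R]_q) (gy : 'rV[R]_q -> 'rV[R]_p -> 'rV[R]_p)
  (xs : 'rV[R]_q) (ys : 'rV[R]_p) : Prop :=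
  [/\ dom g xs, dom fs ys, subdiff g xs (- gx xs ys) & subdiff fs ys (gy xs ys)].

Definition lagr {p q : nat} (g : 'rV[R]_q -> \bar R) (fs : 'rV[R]_p -> \bar R)
  (Phi : 'rV[R]_q -> 'rV[R]_p -> R) (x : 'rV[R]_q) (y : 'rV[R]_p) : \bar R :=
  (g x + (Phi x y)%:E - fs y)%E.

Definition delta_seq (tau : nat -> R) (n : nat) : R :=
  if n is n'.+1 then tau n'.+1 / tau n' else 1.

(* r_n = omega delta_{n-1} ||x_n - x_{n-1}||^2 + (1/beta) ||y_n - y_{n-1}||^2,
   written for a (candidate) value yn of y_n *)
Definition r_val {p q : nat} (omega beta : R) (x : nat -> 'rV[R]_q)
  (y : nat -> 'rV[R]_p) (tau : nat -> R) (n : nat) (yn : 'rV[R]_p) : R :=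
  omega * delta_seq tau n.-1 * (enorm (x n - x n.-1)) ^+ 2
  + (enorm (yn - y n.-1)) ^+ 2 / beta.

Definition r_seq {p q : nat} (omega beta : R) (x : nat -> 'rV[R]_q)
  (y : nat -> 'rV[R]_p) (tau : nat -> R) (n : nat) : R :=
  r_val omega beta x y tau n (y n).

Definition c_seq {p q : nat} (omega beta eta : R) (M : nat) (x : nat -> 'rV[R]_q)
  (y : nat -> 'rV[R]_p) (tau : nat -> R) (n : nat) : R :=
  if (n <= 1)%N then 0 else
  eta / ((n - maxn (n - M) 1)%:R)
    * \sum_(maxn (n - M) 1 <= i < n) r_seq omega beta x y tau i.

Definition ls_cond {p q : nat} (Phi : 'rV[R]_q -> 'rV[R]_p -> R)
  (gx : 'rV[R]_q -> 'rV[R]_p -> 'rV[R]_q) (gy : 'rV[R]_q -> 'rV[R]_p -> 'rV[R]_p)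
  (xi nu eta omega beta : R) (M : nat) (x : nat -> 'rV[R]_q)
  (y : nat -> 'rV[R]_p) (tau : nat -> R) (n : nat) (tn : R) (yn : 'rV[R]_p) : Prop :=
  let theta := gx (x n) yn - gx (x n.-1) (y n.-1) in
  let Phiy := Phi (x n) (y n.-1) + dot (gy (x n) (y n.-1)) (yn - y n.-1)
              - Phi (x n) yn in
  tn * tau n.-1 / xi * (enorm theta) ^+ 2 + 2 * tn * Phiy
  <= nu * r_val omega beta x y tau n yn
     + (1 - nu) * c_seq omega beta eta M x y tau n.

Definition PDAcL_run {p q : nat} (g : 'rV[R]_q -> \bar R) (fs : 'rV[R]_p -> \bar R)
  (Phi : 'rV[R]_q -> 'rV[R]_p -> R)
  (gx : 'rV[R]_q -> 'rV[R]_p -> 'rV[R]_q) (gy : 'rV[R]_q -> 'rV[R]_p -> 'rV[R]_p)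
  (psi xi phi tau_max nu mu eta beta : R) (M : nat)
  (x z : nat -> 'rV[R]_q) (y : nat -> 'rV[R]_p) (tau : nat -> R)
  (i : nat -> nat) : Prop :=
  let omega := 2 * psi - xi - psi ^+ 3 * phi / (1 + psi) in
  z 0%N = x 0%N /\
  forall n : nat, (1 <= n)%N ->
    [/\ z n = (psi - 1) / psi *: x n.-1 + psi^-1 *: z n.-1,
        is_prox (tau n.-1) g (z n - tau n.-1 *: gx (x n.-1) (y n.-1)) (x n) &
      [/\ tau n = Num.min (phi * tau n.-1) tau_max * mu ^+ i n,
        is_prox (beta * tau n) fs (y n.-1 + (beta * tau n) *: gy (x n) (y n.-1)) (y n),
        ls_cond Phi gx gy xi nu eta omega beta M x y tau n (tau n) (y n) &
        forall j : nat, (j < i n)%N ->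
          let tj := Num.min (phi * tau n.-1) tau_max * mu ^+ j in
          forall yj, is_prox (beta * tj) fs (y n.-1 + (beta * tj) *: gy (x n) (y n.-1)) yj ->
            ~ ls_cond Phi gx gy xi nu eta omega beta M x y tau n tj yj]].

End Defs.

(* Main.v *)
(* For a saddle point (xs, ys) the prox inequalities of three consecutive steps,
   the convexity-concavity of Phi and the line search combine into the decrease, up
   to the averages c_n, of the energy
     psi / (psi - 1) |z_(n+2) - xs|^2 + |y_n - ys|^2 / beta
       + omega delta_n |x_(n+1) - x_n|^2.
   Adding a weighted sum of the last M values of r absorbs c_n and gives a
   nonincreasing potential, whose decrease controls r_n: the iterates are bounded
   and r_n tends to 0.  A rejected trial step cannot be small, because a small one
   passes the line search on the bounded region visited (the trial points are bounded
   too), so the step sizes stay away from 0.  Hence every cluster point is a saddle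
   point; the potential attached to it is nonincreasing and arbitrarily small at some
   indices, so it tends to 0 and the whole sequence converges. *)
Require Import Defs.
From HB Require Import structures.
From mathcomp Require Import all_boot all_order all_algebra.
From mathcomp Require Import all_classical all_reals all_analysis.
From mathcomp Require Import ring lra zify.
Import Order.TTheory GRing.Theory Num.Theory.
Import numFieldNormedType.Exports.
Local Open Scope classical_set_scope.
Local Open Scope ring_scope.

(** (A2) controls [gy] in its second argument only, so along the iterates [gy (x n)] is not known to
    be bounded or continuous in [x n]. Wherever this would matter, values of [Phi] are used instead:
    they are controlled in [x] through [gx] and in [y] through concavity. The domains need not be
    closed either, so a cluster point has to be placed in them before any gradient at it can be
    used. The three terms of [omega] have separate origins. The term 2 psi comes from the earlier
    prox inequality, where x_n - z_n = psi (x_n - z_(n+1)). Young's inequality on the cross term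
    this produces, with delta_n <= phi, costs psi^3 phi / (1 + psi). Young's inequality on theta_n
    against x_(n+1) - x_n costs xi. The ratio delta_n has no lower bound until the step sizes have
    one, which looks circular. The way out is delta_n >= tau_n / tau_max: the line search multiplies
    |theta|^2 by the same step size, which makes up for a small ratio. *)

Section Euclidean.
Context {R : realType} {n : nat}.
Implicit Types (u v w : 'rV[R]_n) (a : R).

(** * Inner product and Euclidean norm, and their comparison with the max norm *)

Lemma dotC u v : dot u v = dot v u.
Proof. by apply: eq_bigr => i _; rewrite mulrC. Qed.

Lemma dotDl u v w : dot (u + v) w = dot u w + dot v w.
Proof. by rewrite -big_split; apply: eq_bigr => i _; rewrite mxE mulrDl. Qed.

Lemma dotZl a u v : dot (a *: u) v = a * dot u v.
Proof. by rewrite mulr_sumr; apply: eq_bigr => i _; rewrite mxE mulrA. Qed.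

Lemma dotNl u v : dot (- u) v = - dot u v.
Proof. by rewrite -scaleN1r dotZl mulN1r. Qed.

Lemma dotBl u v w : dot (u - v) w = dot u w - dot v w.
Proof. by rewrite dotDl dotNl. Qed.

Lemma dotDr u v w : dot w (u + v) = dot w u + dot w v.
Proof. by rewrite !(dotC w) dotDl. Qed.

Lemma dotZr a u v : dot v (a *: u) = a * dot v u.
Proof. by rewrite !(dotC v) dotZl. Qed.

Lemma dotNr u v : dot v (- u) = - dot v u.
Proof. by rewrite !(dotC v) dotNl. Qed.

Lemma dotBr u v w : dot w (u - v) = dot w u - dot w v.
Proof. by rewrite dotDr dotNr. Qed.

Definition dotE := (dotDl, dotDr, dotNl, dotNr, dotZl, dotZr).

Lemma dot_ge0 u : 0 <= dot u u.
Proof. by apply: sumr_ge0 => i _; rewrite -expr2 sqr_ge0. Qed.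

Lemma enorm_ge0 u : 0 <= enorm u.
Proof. exact: sqrtr_ge0. Qed.

Lemma sqr_enorm u : enorm u ^+ 2 = dot u u.
Proof. by rewrite sqr_sqrtr ?dot_ge0. Qed.

Lemma sqr_enormD u v :
  enorm (u + v) ^+ 2 = enorm u ^+ 2 + 2 * dot u v + enorm v ^+ 2.
Proof. by rewrite !sqr_enorm !dotE (dotC v u); ring. Qed.

Lemma enorm0 : enorm (0 : 'rV[R]_n) = 0.
Proof. by rewrite /enorm /dot big1 ?sqrtr0 // => i _; rewrite mxE mul0r. Qed.

Lemma enormZ a u : enorm (a *: u) = `|a| * enorm u.
Proof. by rewrite /enorm dotZl dotZr mulrA -expr2 sqrtrM ?sqr_ge0 // sqrtr_sqr. Qed.

Lemma enormN u : enorm (- u) = enorm u.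
Proof. by rewrite -scaleN1r enormZ normrN1 mul1r. Qed.

Lemma enormB u v : enorm (u - v) = enorm (v - u).
Proof. by rewrite -opprB enormN. Qed.

Lemma entry_le_enorm u i : `|u 0 i| <= enorm u.
Proof.
rewrite -sqrtr_sqr ler_sqrt ?dot_ge0 // /dot (bigD1 i) //= expr2 lerDl.
by apply: sumr_ge0 => j _; rewrite -expr2 sqr_ge0.
Qed.

Lemma enorm_eq0 u : enorm u = 0 -> u = 0.
Proof.
move=> u0; apply/rowP => i; rewrite mxE.
by apply/eqP; rewrite -normr_le0 -u0; exact: entry_le_enorm.
Qed.

(** Cauchy-Schwarz from the square of |v| u - |u| v, which is 2 |u| |v| (|u| |v| - dot u v); the
    zero vectors are split off so that |u| |v| can be cancelled. *)
Lemma dot_le_enorm u v : dot u v <= enorm u * enorm v.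
Proof.
have := enorm_ge0 u; rewrite le_eqVlt => /predU1P[/esym u0|u_gt0].
  by rewrite (enorm_eq0 _ u0) enorm0 mul0r /dot big1 // => i _; rewrite mxE mul0r.
have := enorm_ge0 v; rewrite le_eqVlt => /predU1P[/esym v0|v_gt0].
  by rewrite (enorm_eq0 _ v0) enorm0 mulr0 /dot big1 // => i _; rewrite mxE mulr0.
have := dot_ge0 (enorm v *: u - enorm u *: v).
rewrite !dotE -!sqr_enorm (dotC v u).
have uv : 0 < enorm u * enorm v by exact: mulr_gt0.
move: (dot u v) (enorm u) (enorm v) uv => d s t st h.
by rewrite -(ler_pM2l st); nra.
Qed.

Lemma normr_dot_le u v : `|dot u v| <= enorm u * enorm v.
Proof. by rewrite ler_norml dot_le_enorm lerNl -dotNl -(enormN u) dot_le_enorm. Qed.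

Lemma ler_enormD u v : enorm (u + v) <= enorm u + enorm v.
Proof.
rewrite -(ler_pXn2r (n := 2)) ?nnegrE ?addr_ge0 ?enorm_ge0 //.
rewrite sqr_enorm sqrrD !dotE -!sqr_enorm (dotC v u) mulr2n.
have := dot_le_enorm u v; lra.
Qed.

Lemma ler_enormB u v : enorm (u - v) <= enorm u + enorm v.
Proof. by rewrite -(enormN v) ler_enormD. Qed.

Lemma ler_enorm_trans w u v : enorm (u - v) <= enorm (u - w) + enorm (w - v).
Proof. by rewrite -{1}(subrK w u) -addrA ler_enormD. Qed.

Lemma dot_young a u v : 0 < a -> 2 * dot u v <= a * dot u u + dot v v / a.
Proof.
move=> a_gt0; have := dot_ge0 (a *: u - v); rewrite !dotE (dotC v u) => h.
rewrite -(ler_pM2l a_gt0) mulrDr [a * (dot v v / a)]mulrC divfK ?gt_eqF //.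
lra.
Qed.

Lemma normr_le_enorm u : `|u| <= enorm u.
Proof.
rewrite [`|u|]mx_normrE; apply/bigmax_leP; split; first exact: enorm_ge0.
by move=> [j i] _; rewrite /= ord1 entry_le_enorm.
Qed.

(** A crude factor instead of the square root of [n] suffices, since it only serves to show that
    both norms have the same topology. *)
Lemma enorm_le_normr u : enorm u <= n%:R * `|u|.
Proof.
have entry i : `|u 0 i| <= `|u|.
  rewrite [`|u|]mx_normrE.
  by apply: (le_bigmax_cond _ (fun k : 'I_1 * 'I_n => `|u k.1 k.2|) (j := (0, i))).
rewrite -(ler_pXn2r (n := 2)) ?nnegrE ?mulr_ge0 ?enorm_ge0 // sqr_enorm.
apply: (@le_trans _ _ (\sum_(i < n) `|u| ^+ 2)).
  apply: ler_sum => i _; rewrite -expr2 -real_normK ?num_real //.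
  by rewrite ler_pXn2r ?nnegrE.
rewrite sumr_const card_ord -[_ *+ n]mulr_natl exprMn ler_wpM2r ?sqr_ge0 //.
by rewrite -natrX ler_nat; case: (n) => // k; rewrite leq_pmulr.
Qed.

Lemma enorm_bounded_set (K : R) : bounded_set [set u : 'rV[R]_n | enorm u <= K].
Proof.
exists K; split; first exact: num_real.
by move=> L /ltW KL u /= uK; rewrite (le_trans (normr_le_enorm u)) // (le_trans uK).
Qed.

Lemma nbhs_enorm u (A : set 'rV[R]_n) : nbhs u A ->
  exists2 e : R, 0 < e & forall v, enorm (v - u) < e -> A v.
Proof.
move=> /nbhs_ballP[e /= e_gt0 eA]; exists e => // v ve.
apply: eA; rewrite mx_norm_ball /ball_ /=.
by rewrite (le_lt_trans (normr_le_enorm _)) // enormB.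
Qed.

Lemma enorm_nbhs u (e : R) : 0 < e -> nbhs u [set v | enorm (v - u) < e].
Proof.
move=> e_gt0; apply/nbhs_ballP; exists (e / n.+1%:R) => /=; first by rewrite divr_gt0.
move=> v; rewrite mx_norm_ball /ball_ /= ltr_pdivlMr ?ltr0n // => uv.
rewrite enormB (le_lt_trans (enorm_le_normr _)) // (le_lt_trans _ uv) // mulrC.
by rewrite ler_wpM2l // ler_nat.
Qed.

Lemma cvg_enorm (x : nat -> 'rV[R]_n) l :
  (forall e : R, 0 < e -> exists N, forall k, (N <= k)%N -> enorm (x k - l) <= e) ->
  x @ \oo --> l.
Proof.
move=> xl; apply/cvgrPdist_le => e e_gt0; have [N Nl] := xl e e_gt0.
exists N => // k /= Nk; rewrite distrC (le_trans (normr_le_enorm _)) //.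
exact: Nl.
Qed.

End Euclidean.

(** * Compactness of bounded sequences *)

Section ClusterPoints.
Context {R : realType}.

(** Compactness is applied to the product of two balls, so that both sequences come close to their
    limits at a common index. *)
Lemma bounded_cluster_pair {p q : nat} (x : nat -> 'rV[R]_q) (y : nat -> 'rV[R]_p)
    (K : R) (N : nat) :
  (forall k, (N <= k)%N -> enorm (x k) <= K /\ enorm (y k) <= K) ->
  exists xb yb, forall e : R, 0 < e -> forall N', exists k,
    [/\ (N' <= k)%N, enorm (x k - xb) <= e & enorm (y k - yb) <= e].
Proof.
move=> xyK.
have ballK m : compact [set u : 'rV[R]_m | `|u| <= K].
  apply: bounded_closed_compact.
    exists K; split; first exact: num_real.
    by move=> L /ltW KL u /= uK; rewrite (le_trans uK).
  have -> : [set u : 'rV[R]_m | `|u| <= K] = (fun u => `|u|) @^-1` [set t | t <= K].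
    by [].
  by apply: closed_comp => [u _|]; [exact: norm_continuous|exact: closed_le].
have cK := compact_setX (ballK q) (ballK p).
have [|[xb yb] [_ cl]] := cK ((fun k => (x k, y k)) @ \oo) _.
  exists N => // k /= /xyK[xK yK].
  by split => /=; rewrite (le_trans (normr_le_enorm _)).
exists xb, yb => e e_gt0 N'.
pose d := e / (1 + (q + p)%:R).
have d_gt0 : 0 < d by rewrite divr_gt0 // ltr_pwDl.
have nb : nbhs (xb, yb) (ball xb d `*` ball yb d).
  by exists (ball xb d, ball yb d) => //; split; exact: nbhsx_ballx.
have tail : nbhs ((fun k => (x k, y k)) @ \oo)
    [set w | exists2 k, (N' <= k)%N & (x k, y k) = w].
  by exists N' => // k /= Nk; exists k.
have [_ [[k Nk <-] [/= xkb ykb]]] := cl _ _ tail nb.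
move: xkb ykb; rewrite !mx_norm_ball /ball_ /= => /ltW xkb /ltW ykb.
have small m (u : 'rV[R]_m) : (m <= q + p)%N -> `|u| <= d -> enorm u <= e.
  move=> mqp ud; rewrite (le_trans (enorm_le_normr u)) //.
  have -> : e = (1 + (q + p)%:R) * d by rewrite mulrC divfK // gt_eqF // ltr_pwDl.
  by rewrite ler_pM // (@le_trans _ _ (q + p)%:R) ?ler_nat ?lerDr.
by exists k; split=> //; rewrite enormB small // (leq_addr, leq_addl).
Qed.

End ClusterPoints.

(** * Gradients along segments, subgradients, lower semicontinuity and proximal points *)

Section ConvexAnalysis.
Context {R : realType} {n : nat}.
Implicit Types (a b u v w : 'rV[R]_n) (h : 'rV[R]_n -> \bar R).

Lemma has_gradN (k : 'rV[R]_n -> R) a v :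
  has_grad k a v -> has_grad (fun u => - k u) a (- v).
Proof.
move=> kv e /kv[d d_gt0 kd]; exists d => // u /kd.
rewrite dotNl -[X in X <= _ -> _]normrN; congr (`|_| <= _); ring.
Qed.

Lemma has_grad_half_sqr a u :
  has_grad (fun v => enorm (v - a) ^+ 2 / 2) u (u - a).
Proof.
move=> e e_gt0; exists e => // w we.
have -> : u + w - a = (u - a) + w by rewrite addrAC.
rewrite sqr_enormD.
have -> : (enorm (u - a) ^+ 2 + 2 * dot (u - a) w + enorm w ^+ 2) / 2 -
   enorm (u - a) ^+ 2 / 2 - dot (u - a) w = enorm w ^+ 2 / 2 by field.
rewrite ger0_norm ?divr_ge0 ?sqr_ge0 // expr2.
have := enorm_ge0 w; nra.
Qed.

(** The quotients of the chords from [a] towards [b] tend to the directional derivative. The prox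
    inequality, the gradient inequalities for [Phi] and the optimality of the limit in [y] are all
    obtained this way. *)
Lemma has_grad_chord_le (k : 'rV[R]_n -> R) a b v (c : R) :
  has_grad k a v ->
  (forall t, 0 < t <= 1 -> k (a + t *: (b - a)) - k a <= t * c) ->
  dot v (b - a) <= c.
Proof.
move=> kv chord; rewrite leNgt; apply/negP => cv.
set d := b - a in chord cv *; have d_ge0 := enorm_ge0 d.
(* With this [e] the error e |d| stays below half of the gap; the added 1 covers d = 0. *)
pose e := (dot v d - c) / (2 * (enorm d + 1)).
have e_gt0 : 0 < e by rewrite divr_gt0 ?subr_gt0 // mulr_gt0 // ltr_wpDl.
have [r r_gt0 kr] := kv e e_gt0.
pose t := Num.min 1 (r / (2 * (enorm d + 1))).
have t_gt0 : 0 < t by rewrite lt_min ltr01 divr_gt0 // mulr_gt0 // ltr_wpDl.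
have tr : t * (2 * (enorm d + 1)) <= r.
  by rewrite -ler_pdivlMr ?ge_min ?lexx ?orbT // mulr_gt0 // ltr_wpDl.
have ed : e * (2 * (enorm d + 1)) = dot v d - c.
  by rewrite /e divfK // gt_eqF // mulr_gt0 // ltr_wpDl.
have /kr : enorm (t *: d) < r by rewrite enormZ gtr0_norm //; nra.
rewrite ler_norml dotZr enormZ gtr0_norm // => /andP[lo _].
have /chord : 0 < t <= 1 by rewrite t_gt0 ge_min lexx.
have : t * (e * enorm d) < t * (dot v d - c) by rewrite ltr_pM2l //; nra.
lra.
Qed.

Lemma dom_fineK {h u} : h u != -oo%E -> dom h u -> h u = (fine (h u))%:E.
Proof. by rewrite /dom /=; case: (h u). Qed.

Lemma dom_le_fin h u (c : R) : (h u <= c%:E)%E -> dom h u.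
Proof. by move=> hu; rewrite /dom /= (le_lt_trans hu) ?ltry. Qed.

Lemma convex_efun_fine h : (forall u, h u != -oo%E) -> convex_efun h ->
  forall u v t, dom h u -> dom h v -> 0 <= t <= 1 ->
  dom h (t *: u + (1 - t) *: v) /\
  fine (h (t *: u + (1 - t) *: v)) <= t * fine (h u) + (1 - t) * fine (h v).
Proof.
move=> hN hc u v t hu hv t01; have := hc u v t t01.
rewrite (dom_fineK (hN u) hu) (dom_fineK (hN v) hv) -!EFinM -EFinD => le_uv.
have dt := dom_le_fin _ _ _ le_uv; split => //.
by move: le_uv; rewrite (dom_fineK (hN _) dt) lee_fin.
Qed.

Lemma subdiff_dom h u v : (forall w, h w != -oo%E) -> subdiff h u v <->
  dom h u /\ forall w, dom h w -> fine (h u) + dot v (w - u) <= fine (h w).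
Proof.
move=> hN; split=> [[hu sub]|[hu sub]].
  have du : dom h u by rewrite /dom /= ltey_eq hu.
  split=> // w hw; have := sub w.
  by rewrite (dom_fineK (hN u) du) (dom_fineK (hN w) hw) -EFinD lee_fin.
split; first by rewrite (dom_fineK (hN u) hu).
move=> w; have [hw|] := pselect (dom h w).
  by rewrite (dom_fineK (hN u) hu) (dom_fineK (hN w) hw) -EFinD lee_fin sub.
by rewrite /dom /=; move: (hN w); case: (h w) => [s| |] //=; rewrite ?ltry ?leey.
Qed.

Lemma segment_combination a b (t : R) : a + t *: (b - a) = t *: b + (1 - t) *: a.
Proof. by apply/rowP => j; rewrite !mxE; ring. Qed.

(** Comparing [u] with u + t (w - u) and using convexity of [h] bounds the chords of minus the half
    squared distance to [a], whose gradient at [u] is a - u. *)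
Lemma is_prox_vi h (lam : R) a u :
  (forall v, h v != -oo%E) -> convex_efun h -> 0 < lam -> is_prox lam h a u ->
  forall w, dom h w -> dom h u /\
    lam * (fine (h u) - fine (h w)) <= dot (u - a) (w - u).
Proof.
move=> hN hc lam_gt0 pu w hw.
have hu : dom h u.
  have := pu w; rewrite (dom_fineK (hN w) hw) -EFinD /dom /=.
  by move: (hN u); case: (h u) => [r| |] //=; rewrite ?ltry // leye_eq.
split => //; rewrite -lerN2 -dotNl.
apply: (has_grad_chord_le _ _ _ _ _ (has_gradN _ _ _ (has_grad_half_sqr a u))).
move=> t /andP[t_gt0 t_le1].
have t01 : 0 <= t <= 1 by rewrite ltW.
have := pu (u + t *: (w - u)); rewrite segment_combination.
have [dt ct] := convex_efun_fine _ hN hc _ _ _ hw hu t01.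
rewrite (dom_fineK (hN _) hu) (dom_fineK (hN _) dt) -!EFinD lee_fin.
set s1 := enorm _ ^+ 2; set s2 := enorm _ ^+ 2 => le_t.
have : lam * (s1 / (2 * lam) - s2 / (2 * lam)) <=
    lam * (t * (fine (h w) - fine (h u))) by rewrite ler_pM2l //; lra.
have -> : lam * (s1 / (2 * lam) - s2 / (2 * lam)) = s1 / 2 - s2 / 2.
  by field; rewrite gt_eqF.
lra.
Qed.

(** Lower semicontinuity in the form used at cluster points: one nearby point for each [e], with a
    value error linear in [e]. Restricting to e <= 1 lets callers absorb quadratic errors into the
    linear one. *)
Lemma lower_semicontinuous_le h u (c C : R) : lower_semicontinuous h ->
  (forall e : R, 0 < e <= 1 ->
    exists2 v, enorm (v - u) <= e & (h v <= (c + C * e)%:E)%E) ->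
  (h u <= c%:E)%E.
Proof.
move=> hl near_le; rewrite leNgt; apply/negP => cu.
have [d d_gt0 du] : exists2 d : R, 0 < d & ((c + d)%:E < h u)%E.
  move: cu; case: (h u) => [r| |] //=; rewrite ?lte_fin => cr; last by exists 1; rewrite ?ltry.
  by exists ((r - c) / 2); rewrite ?lte_fin; lra.
have [A /nbhs_enorm[e0 e0_gt0 eA] Ah] := hl _ _ du.
pose e : R := Num.min 1 (Num.min (e0 / 2) (d / (`|C| + 1))).
have C1_gt0 : 0 < `|C| + 1 by rewrite ltr_wpDl.
have e_gt0 : 0 < e by rewrite !lt_min ltr01 !divr_gt0.
have [|v ve hv] := near_le e; first by rewrite e_gt0 ge_min lexx.
have /eA/Ah : enorm (v - u) < e0.
  rewrite (le_lt_trans ve) // (@le_lt_trans _ _ (e0 / 2)) ?ge_min ?lexx ?orbT //.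
  lra.
apply/negP; rewrite -leNgt (le_trans hv) // lee_fin lerD2l.
have : e * (`|C| + 1) <= d by rewrite -ler_pdivlMr // !ge_min lexx !orbT.
have := ler_norm C; nra.
Qed.

Lemma fine_lower_semicontinuous_le h u (c C : R) :
  (forall v, h v != -oo%E) -> lower_semicontinuous h ->
  (forall e : R, 0 < e <= 1 -> exists2 v, enorm (v - u) <= e &
    dom h v /\ fine (h v) <= c + C * e) ->
  dom h u /\ fine (h u) <= c.
Proof.
move=> hN hl near_le; have hu : (h u <= c%:E)%E.
  apply: (lower_semicontinuous_le _ _ _ C hl) => e /near_le[v ve [hv hvc]].
  by exists v => //; rewrite (dom_fineK (hN v) hv) lee_fin.
have du := dom_le_fin _ _ _ hu; split => //.
by rewrite -lee_fin -(dom_fineK (hN u) du).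
Qed.

(** The affine minorant is dominated by the quadratic term, so minimising sequences are bounded;
    lower semicontinuity makes a cluster point of one a minimiser. *)
Lemma prox_exists h (lam c : R) a b w : lower_semicontinuous h ->
  (forall v, (dot b v - c)%:E <= h v)%E -> dom h w -> 0 < lam ->
  exists u, is_prox lam h a u.
Proof.
move=> hl hb hw lam_gt0.
have hN v : h v != -oo%E by apply: contraTN (hb v) => /eqP->.
pose H v := fine (h v) + enorm (v - a) ^+ 2 / (2 * lam).
have HL v : dom h v -> dot b v - c <= fine (h v).
  by move=> hv; rewrite -lee_fin -(dom_fineK (hN v) hv).
have l2_gt0 : 0 < 2 * lam by rewrite mulr_gt0.
have Hlow v : dom h v ->
    enorm (v - a) ^+ 2 <= 2 * lam * (H v + c - dot b a + enorm b * enorm (v - a)).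
  move=> hv; rewrite -ler_pdivrMl // mulrC.
  have := HL v hv; have := normr_dot_le b (v - a).
  rewrite ler_norml dotBr /H => /andP[]; lra.
pose S := [set H v | v in dom h].
have S0 : S !=set0 by exists (H w); exists w.
have Slb : has_lbound S.
  exists (dot b a - c - lam * enorm b ^+ 2 / 2) => _ [v /Hlow hv <-].
  rewrite -(ler_pM2l l2_gt0); have := sqr_ge0 (enorm (v - a) - lam * enorm b).
  lra.
have Sinf : has_inf S by [].
have infS_le v : dom h v -> inf S <= H v by move=> hv; apply: ge_inf => //; exists v.
have /choice[x xS] (k : nat) : exists v, dom h v /\ H v <= inf S + k.+1%:R^-1.
  have k_gt0 : 0 < k.+1%:R^-1 :> R by rewrite invr_gt0 ltr0n.
  by have [_ [v hv <-] /ltW] := inf_adherent k_gt0 Sinf; exists v.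
have xinf k : H (x k) <= inf S + 1.
  have [_ /le_trans->//] := xS k.
  by rewrite lerD2l invf_le1 ?ltr0n // ler1n.
pose A := 2 * lam * `|inf S + 1 + c - dot b a|; pose B := 2 * lam * enorm b.
(* If s^2 <= A + B s with A, B >= 0, then s <= A + B + 1. *)
have xK k : enorm (x k) <= A + B + 1 + enorm a.
  have [/Hlow xk _] := xS k; have xik := xinf k.
  have : enorm (x k) <= enorm (x k - a) + enorm a by rewrite -{1}(subrK a (x k)) ler_enormD.
  have B_ge0 : 0 <= B by rewrite mulr_ge0 ?enorm_ge0 // ltW.
  have A_ge0 : 0 <= A by rewrite mulr_ge0 // ltW.
  have : enorm (x k - a) ^+ 2 <= A + B * enorm (x k - a).
    rewrite (le_trans xk) // mulrDr lerD ?mulrA // ler_pM2l //.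
    by rewrite (le_trans _ (ler_norm _)) //; lra.
  have := enorm_ge0 (x k - a); nra.
have [u [u' ucl]] := bounded_cluster_pair x x _ 0 (fun k _ => conj (xK k) (xK k)).
(* This says that the objective at [u] is at most its infimum, with the quadratic term moved to the
   right so that lower semicontinuity of [h] alone applies. In the error constant, 1 pays for
   1/(k+1) and the quotient for the change of the quadratic term between [x k] and [u]. *)
have hu : (h u <= (inf S - enorm (u - a) ^+ 2 / (2 * lam))%:E)%E.
  apply: (lower_semicontinuous_le _ _ _ (1 + 2 * enorm (u - a) / (2 * lam)) hl) => e /andP[e_gt0 _].
  have [N Ne] : exists N, N.+1%:R^-1 <= e.
    have [N _ /(_ N (leqnn N)) /= Ne] := near_infty_natSinv_lt (PosNum e_gt0).
    by exists N; apply: ltW.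
  have [k [Nk xu _]] := ucl e e_gt0 N; exists (x k) => //.
  have [hk Hk] := xS k; rewrite (dom_fineK (hN _) hk) lee_fin.
  have kN : k.+1%:R^-1 <= N.+1%:R^-1 :> R by rewrite lef_pV2 ?posrE ?ltr0n // ler_nat.
  have : enorm (u - a) ^+ 2 - 2 * e * enorm (u - a) <= enorm (x k - a) ^+ 2.
    have -> : x k - a = (x k - u) + (u - a) by rewrite addrA subrK.
    rewrite sqr_enormD; have := normr_dot_le (x k - u) (u - a).
    rewrite ler_norml => /andP[lo _]; have := sqr_ge0 (enorm (x k - u)).
    have := ler_wpM2r (enorm_ge0 (u - a)) xu; lra.
  have il2_ge0 : 0 <= (2 * lam)^-1 by rewrite invr_ge0 ltW.
  move=> /(ler_wpM2r il2_ge0); rewrite mulrBl.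
  move: Hk; rewrite /H; move: kN Ne.
  move: (_^-1) (_^-1) (2 * lam)^-1 => *; lra.
have du := dom_le_fin _ _ _ hu.
exists u => v; have [hv|] := pselect (dom h v); last first.
  rewrite /dom /=; move: (hN v); case: (h v) => [r| |] //=; rewrite ?ltry //.
  by move=> _ _; rewrite addye ?leey.
move: hu; rewrite (dom_fineK (hN u) du) (dom_fineK (hN v) hv) -!EFinD !lee_fin.
have := infS_le v hv; rewrite /H; lra.
Qed.

End ConvexAnalysis.

(** * The conjugate as a closed convex function with an affine minorant *)

Section FenchelConjugate.
Context {R : realType} {n : nat}.
Implicit Types (u v w : 'rV[R]_n) (h : 'rV[R]_n -> \bar R).

Lemma fconj_ge h u y : ((dot y u)%:E - h u <= fconj h y)%E.
Proof.
by apply: le_ereal_sup_tmp; exists ((dot y u)%:E - h u)%E; [exists u|rewrite lexx].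
Qed.

Lemma proper_fun_affine_minorant h : proper_fun h ->
  exists u (c : R), forall y, ((dot u y - c)%:E <= fconj h y)%E.
Proof.
move=> [_ [u hu]]; exists u, (fine (h u)) => y.
by rewrite EFinB fineK // dotC; exact: fconj_ge.
Qed.

Lemma fconjNy h y : proper_fun h -> fconj h y != -oo%E.
Proof.
move=> /proper_fun_affine_minorant[u [c /(_ y)]].
by apply: contraTN => /eqP->.
Qed.

Lemma fconj_convex h : proper_fun h -> convex_efun (fconj h).
Proof.
move=> [hN _] y1 y2 t /andP[t_ge0 t_le1]; apply: ge_ereal_sup => _ [u _ <-].
apply: (@le_trans _ _ (t%:E * ((dot y1 u)%:E - h u) +
                       (1 - t)%:E * ((dot y2 u)%:E - h u))%E); last first.
  by apply: leeD; apply: lee_wpmul2l; rewrite ?lee_fin ?subr_ge0 //; exact: fconj_ge.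
move: (hN u); case: (h u) => [r| |] //= _; last by rewrite leNye.
by rewrite -!EFinB -!EFinM -EFinD lee_fin !dotE; lra.
Qed.

(** A supremum of affine functions: one of them that exceeds [a] at [y] still exceeds it near
    [y]. *)
Lemma fconj_lsc h : proper_fun h -> lower_semicontinuous (fconj h).
Proof.
move=> [hN _] y a /ereal_sup_gt[_ [u _ <-]].
move: (hN u); case hu: (h u) => [r| |] //= _.
rewrite -EFinB lte_fin => ar.
have u1_gt0 : 0 < enorm u + 1 by rewrite ltr_wpDl ?enorm_ge0.
exists [set v | enorm (v - y) < (dot y u - r - a) / (enorm u + 1)].
  by apply: enorm_nbhs; rewrite divr_gt0 ?subr_gt0.
move=> w /=; rewrite ltr_pdivlMr // => yw.
apply: lt_le_trans (fconj_ge h u w); rewrite hu -EFinB lte_fin.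
have := normr_dot_le (w - y) u; rewrite ler_norml dotBl => /andP[lo _].
have := enorm_ge0 (w - y); lra.
Qed.

End FenchelConjugate.

(** * One-step inequalities for the primal and the dual update *)

Section EnergyStep.
Context {R : realType}.

(* [psi / (psi - 1)] normalises [enorm (z' - s)] so that the cross term
   [dot (x' - z) (z - s)] produced by the prox inequality at [x'] cancels. *)
Lemma golden_ratio_step {q : nat} (psi xi phi t t0 G0 G1 Gs : R)
    (x x' z0 z z' s g0 g1 : 'rV[R]_q) :
  1 < psi -> 0 < xi -> 0 < t -> 0 < t0 -> t <= phi * t0 ->
  z = (psi - 1) / psi *: x + psi^-1 *: z0 ->
  z' = (psi - 1) / psi *: x' + psi^-1 *: z ->
  t * (G1 - Gs) <= dot (x' - (z - t *: g1)) (s - x') ->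
  t0 * (G0 - G1) <= dot (x - (z0 - t0 *: g0)) (x' - x) ->
  psi / (psi - 1) * enorm (z' - s) ^+ 2
    + (2 * psi - xi - psi ^+ 3 * phi / (1 + psi)) * (t / t0) * enorm (x' - x) ^+ 2
  <= psi / (psi - 1) * enorm (z - s) ^+ 2 + t * t0 / xi * enorm (g1 - g0) ^+ 2
    + 2 * t * dot g1 (s - x) - 2 * t * (G0 - Gs).
Proof.
move=> psi_gt1 xi_gt0 t_gt0 t0_gt0 t_le -> -> vi1 vi0.
have psi_gt0 : 0 < psi by lra.
have psi_neq0 : psi != 0 by rewrite gt_eqF.
have psi1_neq0 : psi - 1 != 0 by rewrite gt_eqF ?subr_gt0.
have psi1'_neq0 : 1 + psi != 0 by rewrite gt_eqF // addr_gt0.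
have t0_neq0 : t0 != 0 by rewrite gt_eqF.
set w := (psi - 1) / psi *: x + psi^-1 *: z0 in vi1 *.
set a := x' - x; set c := x' - w; set e := w - s.
pose k := (psi - 1) / psi; pose P := psi / (psi - 1).
pose Q := psi ^+ 3 / (1 + psi); pose d := t / t0.
have d_gt0 : 0 < d by rewrite divr_gt0.
have Q_gt0 : 0 < Q by rewrite divr_gt0 ?exprn_gt0 // addr_gt0.
have d_le : d <= phi by rewrite ler_pdivrMr.
have {}vi1 : t * (G1 - Gs) <= - dot c c - dot c e - t * (dot g1 c + dot g1 e).
  have e1 : x' - (w - t *: g1) = c + t *: g1.
    by apply/rowP => j; rewrite !mxE; ring.
  have e2 : s - x' = - (c + e) by apply/rowP => j; rewrite !mxE; ring.
  by move: vi1; rewrite e1 e2 !dotE; lra.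
(* The recursion gives x - z0 = psi (x - z), so the earlier prox inequality can also be written
   through [a] and [c]; multiplying by d = t / t0 matches its step size with that of [vi1]. *)
have {}vi0 : t * (G0 - G1) <= d * psi * (dot c a - dot a a) + t * dot g0 a.
  have e1 : x - (z0 - t0 *: g0) = psi *: (c - a) + t0 *: g0.
    by apply/rowP => j; rewrite !mxE; field.
  move: vi0; rewrite e1 -/a !dotE => /(ler_wpM2l (ltW d_gt0)).
  have -> : t = d * t0 by rewrite /d divfK.
  lra.
have -> : k *: x' + psi^-1 *: w - s = e + k *: c.
  by apply/rowP => j; rewrite !mxE /k; field.
have -> : s - x = - (c + e - a) by apply/rowP => j; rewrite !mxE; ring.
clearbody a c e.
rewrite (sqr_enormD e (k *: c)) dotZr enormZ exprMn real_normK ?num_real // (dotC e c).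
rewrite !sqr_enorm -/P -/d.
have -> : P * (dot e e + 2 * (k * dot c e) + k ^+ 2 * dot c c) =
    P * dot e e + 2 * dot c e + k * dot c c.
  by rewrite /P /k; field; rewrite psi_neq0.
have -> : psi ^+ 3 * phi / (1 + psi) = Q * phi by rewrite /Q; ring.
(* The weight 2 - k = 1 + 1/psi is exactly what remains of |c|^2 after expanding |z' - s|^2; it
   turns (d psi)^2 into d^2 psi^3 / (1 + psi). *)
have young1 : 2 * (d * psi) * dot c a <= (2 - k) * dot c c + d ^+ 2 * Q * dot a a.
  have k2_gt0 : 0 < 2 - k.
    have -> : 2 - k = 1 + psi^-1 by rewrite /k; field.
    by rewrite addr_gt0 ?invr_gt0.
  have := dot_young _ c ((d * psi) *: a) k2_gt0; rewrite !dotE.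
  have -> : d * psi * (d * psi * dot a a) / (2 - k) = d ^+ 2 * Q * dot a a.
    by rewrite /k /Q; field; rewrite psi_neq0 psi1'_neq0 //= gt_eqF //; lra.
  lra.
have dQ : d ^+ 2 * Q * dot a a <= Q * phi * d * dot a a.
  rewrite ler_wpM2r ?dot_ge0 //.
  have := ler_wpM2l (ltW (mulr_gt0 d_gt0 Q_gt0)) d_le; lra.
(* This weight leaves the gradient term of the line search on one side and xi d |a|^2, the [xi] part
   of [omega], on the other. *)
have young2 : - (2 * t * dot (g1 - g0) a) <=
    t * t0 / xi * dot (g1 - g0) (g1 - g0) + xi * d * dot a a.
  have k_gt0 : 0 < t * t0 / xi by rewrite divr_gt0 ?mulr_gt0.
  have := dot_young _ (g1 - g0) (- (t *: a)) k_gt0; rewrite dotNr dotNl dotNr opprK.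
  rewrite !dotZl !dotZr.
  have -> : t * (t * dot a a) / (t * t0 / xi) = xi * d * dot a a.
    by rewrite /d; field; rewrite t0_neq0 !gt_eqF.
  lra.
have -> : dot g1 (- (c + e - a)) = - (dot g1 c + dot g1 e - dot g1 a) by rewrite !dotE.
have ga : dot (g1 - g0) a = dot g1 a - dot g0 a by rewrite dotBl.
move: young2 vi0 vi1 young1 dQ; rewrite ga.
move: (dot (g1 - g0) _) (t * t0 / xi) (P * _) => X T Y.
lra.
Qed.

(** Three-point identity: 2 dot (y - y0) (y - s) = |y - s|^2 + |y - y0|^2 - |y0 - s|^2. *)
Lemma proximal_ascent_step {p : nat} (beta t F1 Fs : R) (y y0 s g : 'rV[R]_p) :
  0 < beta ->
  beta * t * (F1 - Fs) <= dot (y - (y0 + (beta * t) *: g)) (s - y) ->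
  enorm (y - s) ^+ 2 / beta + enorm (y - y0) ^+ 2 / beta
  <= enorm (y0 - s) ^+ 2 / beta + 2 * t * dot g (y - s) - 2 * t * (F1 - Fs).
Proof.
move=> b_gt0; set d := y - y0; set h := y0 - s.
have -> : y - s = d + h by apply/rowP => j; rewrite !mxE; ring.
have -> : y - (y0 + (beta * t) *: g) = d - (beta * t) *: g.
  by apply/rowP => j; rewrite !mxE; ring.
have -> : s - y = - (d + h) by apply/rowP => j; rewrite !mxE; ring.
clearbody d h.
rewrite (sqr_enormD d h) !sqr_enorm !dotE => vi.
rewrite -(ler_pM2l b_gt0).
have -> : beta * ((dot d d + 2 * dot d h + dot h h) / beta + dot d d / beta) =
    2 * dot d d + 2 * dot d h + dot h h by field; rewrite gt_eqF.
have -> : beta * (dot h h / beta + 2 * t * (dot g d + dot g h) - 2 * t * (F1 - Fs)) =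
  dot h h + beta * (2 * t * (dot g d + dot g h) - 2 * t * (F1 - Fs)).
  by field; rewrite gt_eqF.
lra.
Qed.

End EnergyStep.

(** * Moving averages, descent and perturbed contractions of real sequences *)

Section RealSequences.
Context {R : realType}.
Implicit Types (a b r : nat -> R) (e eta c kappa : R).

Lemma sum_window_rev r m n : (m <= n)%N ->
  \sum_(k < m) r (n - k.+1)%N = \sum_(n - m <= i < n) r i.
Proof.
elim: m => [_|m IH mn]; first by rewrite big_ord0 subn0 big_geq.
rewrite big_ord_recr IH 1?ltnW //= [RHS]big_ltn; last by rewrite ltn_subrL; case: (n) mn.
by rewrite addrC -subSn // subSS.
Qed.

(* The weight of [r i] in [window_weight eta M r n] is [eta / M] times the number
   of indices [m >= n] whose averaging window [m - M, ..., m - 1] contains [i]. *)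
Definition window_weight eta (M : nat) r n : R :=
  eta / M%:R * \sum_(k < M) \sum_(n - k.+1 <= i < n) r i.

(** Each inner window gains [r n] and loses its oldest term; the [M] lost terms together make up the
    window that is averaged in c_n. The bound M < n keeps the subtractions from being truncated. *)
Lemma window_weightS eta M r n : (0 < M)%N -> (M < n)%N ->
  window_weight eta M r n.+1 =
  window_weight eta M r n + eta * r n - eta / M%:R * \sum_(n - M <= i < n) r i.
Proof.
move=> M_gt0 Mn; rewrite /window_weight.
have -> : \sum_(k < M) \sum_(n.+1 - k.+1 <= i < n.+1) r i =
    \sum_(k < M) (\sum_(n - k.+1 <= i < n) r i + (r n - r (n - k.+1)%N)).
  apply: eq_bigr => k _; have kn := ltn_trans (ltn_ord k) Mn.
  rewrite subSS big_nat_recr ?leq_subr //= [in RHS]big_ltn; last first.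
    by rewrite ltn_subrL /= (leq_trans _ kn).
  by rewrite -subSn // subSS; ring.
rewrite big_split sumrB /= sumr_const card_ord (sum_window_rev r _ _ (ltnW Mn)).
rewrite -[r n *+ M]mulr_natr; field.
by rewrite pnatr_eq0 -lt0n.
Qed.

Lemma window_weight_ge0 eta M r n : 0 <= eta -> (forall k, 0 <= r k) ->
  0 <= window_weight eta M r n.
Proof.
move=> eta_ge0 r_ge0; rewrite mulr_ge0 ?divr_ge0 //.
by apply: sumr_ge0 => k _; apply: sumr_ge0.
Qed.

Lemma window_weight_le eta M r n e : 0 <= eta <= 1 -> (0 < M)%N -> 0 <= e ->
  (forall k, (n - M <= k)%N -> r k <= e) -> window_weight eta M r n <= M%:R * e.
Proof.
move=> /andP[eta_ge0 eta_le1] M_gt0 e_ge0 re.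
have M_neq0 : M%:R != 0 :> R by rewrite pnatr_eq0 -lt0n.
apply: (@le_trans _ _ (eta / M%:R * (M%:R * (M%:R * e)))); last first.
  by rewrite -mulrA mulKf // ler_piMl // mulr_ge0.
rewrite ler_wpM2l ?divr_ge0 //.
rewrite [leRHS]mulr_natl -[M in leRHS]card_ord -sumr_const; apply: ler_sum => k _.
apply: (@le_trans _ _ (\sum_(n - k.+1 <= i < n) e)).
  rewrite !big_nat; apply: ler_sum => i /andP[ni _]; apply: re.
  by rewrite (leq_trans _ ni) // leq_sub2l.
rewrite sumr_const_nat -[_ *+ _]mulr_natl ler_wpM2r // ler_nat.
by rewrite card_ord; have := ltn_ord k; lia.
Qed.

(** Once [b] is within kappa e of its infimum, no later step can decrease it by more than that. *)
Lemma descent_increment_small b r kappa N : 0 < kappa ->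
  (forall m, 0 <= b m) -> (forall m, 0 <= r m) ->
  (forall m, (N <= m)%N -> b m.+1 + kappa * r m.+1 <= b m) ->
  forall e : R, 0 < e -> exists N', forall m, (N' <= m)%N -> r m <= e.
Proof.
move=> kappa_gt0 b_ge0 r_ge0 descent e e_gt0.
pose S := [set b m | m in [set m | (N <= m)%N]].
have Sinf : has_inf S.
  by split; [exists (b N); exists N => /=|exists 0 => _ [m _ <-]].
have ke_gt0 : 0 < kappa * e by rewrite mulr_gt0.
have [_ [m0 /= Nm0 <-] bm0] := inf_adherent ke_gt0 Sinf.
exists m0.+1 => -[//|m]; rewrite ltnS => m0m.
have Nm := leq_trans Nm0 m0m.
have bm : b m <= b m0.
  elim: m m0m Nm => [|m IH]; first by rewrite leqn0 => /eqP->.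
  rewrite leq_eqVlt => /predU1P[->//|]; rewrite ltnS => m0m _.
  have Nm := leq_trans Nm0 m0m.
  have := descent m Nm; have := IH m0m Nm.
  have := mulr_ge0 (ltW kappa_gt0) (r_ge0 m.+1); lra.
have bS : inf S <= b m.+1 by apply: ge_inf; [case: Sinf|exists m.+1; rewrite //= ltnW].
rewrite -(ler_pM2l kappa_gt0); have := descent m Nm; lra.
Qed.

Lemma contraction_small a b c N : 0 <= c < 1 -> (forall m, 0 <= a m) ->
  (forall m, (N <= m)%N -> a m.+1 <= b m + c * a m) ->
  (forall e : R, 0 < e -> exists N', forall m, (N' <= m)%N -> b m <= e) ->
  forall e : R, 0 < e -> exists N', forall m, (N' <= m)%N -> a m <= e.
Proof.
move=> /andP[c_ge0 c_lt1] a_ge0 contr bsmall e e_gt0.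
have c1_gt0 : 0 < 1 - c by rewrite subr_gt0.
(* With this bound on [b], e / 2 is the fixed point of the map s -> b + c s, and only the transient
   c^k remains. *)
have [|N1 bN1] := bsmall (e / 2 * (1 - c)); first by rewrite mulr_gt0 ?divr_gt0.
pose N2 := maxn N N1.
have geo k : a (N2 + k)%N <= e / 2 + c ^+ k * a N2.
  elim: k => [|k IH]; first by rewrite addn0 expr0; lra.
  rewrite addnS exprS.
  have k1 : (N <= N2 + k)%N by rewrite /N2; lia.
  have k2 : (N1 <= N2 + k)%N by rewrite /N2; lia.
  have := contr _ k1; have := bN1 _ k2; have := ler_wpM2l c_ge0 IH; lra.
have [k0 ck0] : exists k0, forall k, (k0 <= k)%N -> c ^+ k * a N2 <= e / 2.
  have a1_gt0 : 0 < a N2 + 1 by rewrite ltr_wpDl.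
  have e2_gt0 : 0 < e / 2 / (a N2 + 1) by rewrite !divr_gt0.
  have cc : `|c| < 1 by rewrite ger0_norm.
  have /cvgrPdist_le /(_ _ e2_gt0)[k0 _ ck0] := cvg_expr cc.
  exists k0 => k /ck0 /=; rewrite sub0r normrN ger0_norm ?exprn_ge0 // ler_pdivlMr // => ck.
  have := exprn_ge0 k c_ge0; lra.
exists (N2 + k0)%N => m Nm; have := geo (m - N2)%N.
rewrite subnKC; last by rewrite (leq_trans _ Nm) // leq_addr.
have : (k0 <= m - N2)%N by lia.
move=> /ck0; lra.
Qed.

End RealSequences.

(** * Estimates for real-valued [G], [F] and convex-concave [Phi] on domains [D1], [D2] *)

Section ConvexConcave.
Context {R : realType} {p q : nat}.
Variables (D1 : set 'rV[R]_q) (D2 : set 'rV[R]_p).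
Variables (G : 'rV[R]_q -> R) (F : 'rV[R]_p -> R) (Phi : 'rV[R]_q -> 'rV[R]_p -> R).
Variables (gx : 'rV[R]_q -> 'rV[R]_p -> 'rV[R]_q) (gy : 'rV[R]_q -> 'rV[R]_p -> 'rV[R]_p).
Implicit Types (x z xs : 'rV[R]_q) (y ys : 'rV[R]_p) (t : R).
Hypothesis Phi_gx : forall a b y, D1 a -> D1 b -> D2 y ->
  Phi a y + dot (gx a y) (b - a) <= Phi b y.
Hypothesis Phi_gy : forall x a b, D1 x -> D2 a -> D2 b ->
  Phi x b <= Phi x a + dot (gy x a) (b - a).
Hypothesis lip : forall K : R, exists2 L : R, 0 <= L & forall x1 x2 y1 y2,
  D1 x1 -> enorm x1 <= K -> D1 x2 -> enorm x2 <= K ->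
  D2 y1 -> enorm y1 <= K -> D2 y2 -> enorm y2 <= K ->
  enorm (gy x1 y1 - gy x1 y2) <= L * enorm (y1 - y2) /\
  enorm (gx x1 y1 - gx x2 y2) <= L * (enorm (x1 - x2) + enorm (y1 - y2)).
Hypothesis D2_convex : forall u v (t : R), D2 u -> D2 v -> 0 <= t <= 1 ->
  D2 (t *: u + (1 - t) *: v).

Definition saddle_ineq xs ys : Prop :=
  [/\ D1 xs, D2 ys, forall w : 'rV[R]_q, D1 w -> G xs - dot (gx xs ys) (w - xs) <= G w &
      forall w, D2 w -> F ys + dot (gy xs ys) (w - ys) <= F w].

(** After adding the two one-step inequalities, what is left over is at least 2 t times the gap L(x,
    ys) - L(xs, y), where L = G + Phi - F, and this gap is nonnegative at a saddle point. *)
Lemma primal_dual_step (psi xi phi beta t t0 : R) x x' z0 z z' xs x0 y y0 ys :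
  saddle_ineq xs ys -> D1 x -> D2 y -> D2 y0 ->
  1 < psi -> 0 < xi -> 0 < beta -> 0 < t -> 0 < t0 -> t <= phi * t0 ->
  z = (psi - 1) / psi *: x + psi^-1 *: z0 ->
  z' = (psi - 1) / psi *: x' + psi^-1 *: z ->
  t * (G x' - G xs) <= dot (x' - (z - t *: gx x y)) (xs - x') ->
  t0 * (G x - G x') <= dot (x - (z0 - t0 *: gx x0 y0)) (x' - x) ->
  beta * t * (F y - F ys) <= dot (y - (y0 + (beta * t) *: gy x y0)) (ys - y) ->
  psi / (psi - 1) * enorm (z' - xs) ^+ 2 + enorm (y - ys) ^+ 2 / beta
    + (2 * psi - xi - psi ^+ 3 * phi / (1 + psi)) * (t / t0) * enorm (x' - x) ^+ 2
    + enorm (y - y0) ^+ 2 / beta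
  <= psi / (psi - 1) * enorm (z - xs) ^+ 2 + enorm (y0 - ys) ^+ 2 / beta
    + (t * t0 / xi * enorm (gx x y - gx x0 y0) ^+ 2
       + 2 * t * (Phi x y0 + dot (gy x y0) (y - y0) - Phi x y)).
Proof.
move=> [Dxs Dys Gs Fs] Dx Dy Dy0 psi1 xi0 beta0 t_gt0 t0_gt0 tt0 zE z'E vi1 vi0 viy.
have := golden_ratio_step psi xi phi t t0 _ _ _ x x' z0 z z' xs _ _
  psi1 xi0 t_gt0 t0_gt0 tt0 zE z'E vi1 vi0.
have := proximal_ascent_step _ _ _ _ _ _ _ _ beta0 viy.
have := Gs x Dx; have := Fs y Dy.
have := Phi_gx x xs y Dx Dxs Dy; have := Phi_gx xs x ys Dxs Dx Dys.
have := Phi_gy x y0 ys Dx Dy0 Dys; have := Phi_gy xs ys y Dxs Dys Dy.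
have -> : dot (gy x y0) (ys - y0) = dot (gy x y0) (y - y0) - dot (gy x y0) (y - ys).
  by rewrite -dotBr; congr (dot _ _); apply/rowP => j; rewrite !mxE; ring.
move=> h1 h2 h3 h4 h5 h6 hy hx.
have : 0 <= t * (Phi x y0 + dot (gy x y0) (y - y0) - Phi x y - dot (gy x y0) (y - ys)
   - dot (gx x y) (xs - x) + (G x - G xs) + (F y - F ys)).
  by apply: mulr_ge0; [exact: ltW|lra].
lra.
Qed.

(** Convexity in [x] moves both values to [xs], where concavity in [y] applies; the only [gy]
    involved is the fixed [gy xs ys], the rest being a difference of [gx]. *)
Lemma Phi_growth (K : R) xs ys : D1 xs -> D2 ys ->
  exists2 C : R, 0 <= C & forall x w, D1 x -> enorm x <= K -> D2 w -> enorm w <= K ->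
    Phi x w - Phi x ys <= C.
Proof.
move=> Dxs Dys; pose K' : R := K + enorm xs + enorm ys.
have [L L_ge0 Lip] := lip K'.
exists (L * (`|K'| + `|K'|) * `|K'| + enorm (gy xs ys) * `|K'|).
  by rewrite addr_ge0 ?mulr_ge0 ?addr_ge0 ?enorm_ge0.
move=> x w Dx xK Dw wK.
have xs_ge0 := enorm_ge0 xs; have ys_ge0 := enorm_ge0 ys.
have x_ge0 := enorm_ge0 x; have w_ge0 := enorm_ge0 w.
have dxK : enorm (x - xs) <= `|K'|.
  by rewrite (le_trans (ler_enormB _ _)) // (le_trans _ (ler_norm _)) // /K'; lra.
have dwK : enorm (w - ys) <= `|K'|.
  by rewrite (le_trans (ler_enormB _ _)) // (le_trans _ (ler_norm _)) // /K'; lra.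
have [||||||||_ gxL] := Lip x xs w ys => //; try by rewrite /K'; lra.
have := Phi_gx x xs w Dx Dxs Dw; have := Phi_gx xs x ys Dxs Dx Dys.
have := Phi_gy xs ys w Dxs Dys Dw.
have := le_trans (dot_le_enorm (gy xs ys) (w - ys)) (ler_wpM2l (enorm_ge0 _) dwK).
have : dot (gx x w - gx xs ys) (x - xs) <= L * (`|K'| + `|K'|) * `|K'|.
  rewrite (le_trans (dot_le_enorm _ _)) // ler_pM ?enorm_ge0 //.
  by rewrite (le_trans gxL) // ler_wpM2l // lerD.
rewrite dotBl.
have -> : dot (gx x w) (xs - x) = - dot (gx x w) (x - xs) by rewrite -dotNr opprB.
lra.
Qed.

(* [gy] is Lipschitz in its second argument only, so its values over bounded
   [x] are controlled through the increments of [Phi], and only in the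
   directions pointing into [D2]. *)
Lemma gy_growth (K : R) xs ys : D1 xs -> D2 ys ->
  exists2 C : R, 0 <= C & forall x w, D1 x -> enorm x <= K -> D2 w ->
    dot (gy x ys) (w - ys) <= C * (1 + enorm (w - ys)).
Proof.
move=> Dxs Dys; pose K' : R := `|K| + enorm ys + 1.
have [L L_ge0 Lip] := lip K'.
have [C C_ge0 PhiC] := Phi_growth K' xs ys Dxs Dys.
have K_le : K <= `|K| by exact: ler_norm.
have K_ge0 : 0 <= `|K| by [].
have ys_ge0 := enorm_ge0 ys.
(* The +1 in [K'] makes room for this unit ball around [ys]. Concavity bounds the pairing with
   [gy x w] by an increment of [Phi], and the Lipschitz bound moves it to [gy x ys]. *)
have unit x w : D1 x -> enorm x <= K -> D2 w -> enorm (w - ys) <= 1 ->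
    dot (gy x ys) (w - ys) <= C + L.
  move=> Dx xK Dw w1.
  have wK : enorm w <= K'.
    have : enorm w <= enorm (w - ys) + enorm ys by rewrite -{1}(subrK ys w) ler_enormD.
    by rewrite /K'; lra.
  have xK' : enorm x <= K' by rewrite /K'; lra.
  have ysK : enorm ys <= K' by rewrite /K'; lra.
  have [gyL _] := Lip x x w ys Dx xK' Dx xK' Dw wK Dys ysK.
  have := PhiC x w Dx xK' Dw wK; have := Phi_gy x w ys Dx Dw Dys.
  have -> : dot (gy x w) (ys - w) = - dot (gy x w) (w - ys) by rewrite -dotNr opprB.
  have : dot (gy x w - gy x ys) (- (w - ys)) <= L * 1.
    rewrite (le_trans (dot_le_enorm _ _)) // enormN.
    by rewrite -[leRHS]mulr1 ler_pM ?enorm_ge0 // mulr1 (le_trans gyL) // ler_piMr.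
  rewrite dotNr dotBl; lra.
exists (C + L) => [|x w Dx xK Dw]; first by rewrite addr_ge0.
have CL_ge0 : 0 <= C + L by rewrite addr_ge0.
have d_ge0 := enorm_ge0 (w - ys).
have [w1|w1] := leP (enorm (w - ys)) 1.
  by have := unit x w Dx xK Dw w1; nra.
have d_gt0 : 0 < enorm (w - ys) by lra.
(* A far point is pulled back to the unit sphere around [ys], staying in [D2] by convexity, and the
   bound is scaled up again. *)
set s := (enorm (w - ys))^-1.
have sd : s * enorm (w - ys) = 1 by rewrite mulVf // gt_eqF.
have s_ge0 : 0 <= s by rewrite invr_ge0.
have s01 : 0 <= s <= 1 by rewrite s_ge0 invf_le1 // ltW.
have Dws := D2_convex w ys s Dw Dys s01.
have ws : s *: w + (1 - s) *: ys - ys = s *: (w - ys).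
  by apply/rowP => j; rewrite !mxE; ring.
have := unit x _ Dx xK Dws.
rewrite ws enormZ ger0_norm // sd dotZr => /(_ (lexx _)) /(ler_wpM2l d_ge0).
by rewrite mulrA [enorm _ * s]mulrC sd; lra.
Qed.

(** Tested at [ys], the prox inequality bounds |yt - ys|^2 by an affine function of |yt - ys|: [F]
    decreases at most linearly because of its subgradient at [ys], and [gy_growth] controls the
    gradient. Only t <= tmax enters, so all trial steps share one bound. *)
Lemma trial_point_bounded (K beta tmax : R) xs ys : saddle_ineq xs ys ->
  0 < beta -> exists C : R, forall x y0 t yt,
  D1 x -> enorm x <= K -> D2 y0 -> enorm y0 <= K -> 0 < t <= tmax ->
  D2 yt ->
  beta * t * (F yt - F ys) <= dot (yt - (y0 + (beta * t) *: gy x y0)) (ys - yt) ->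
  enorm yt <= C.
Proof.
move=> [Dxs Dys _ Fs] beta_gt0.
pose K' : R := `|K| + enorm ys.
have K_le : K <= `|K| by exact: ler_norm.
have K_ge0 : 0 <= `|K| by [].
have ys_ge0 := enorm_ge0 ys.
have [L L_ge0 Lip] := lip K'.
have [C C_ge0 gyC] := gy_growth K xs ys Dxs Dys.
have gs_ge0 := enorm_ge0 (gy xs ys).
pose P := K' + beta * `|tmax| * (L * K' + C + enorm (gy xs ys)).
pose Q := beta * `|tmax| * C.
exists (P + Q + 1 + enorm ys) => x y0 t yt Dx xK Dy0 y0K /andP[t_gt0 t_le] Dyt vi.
set d := yt - ys.
have d_ge0 := enorm_ge0 d.
have xK' : enorm x <= K' by rewrite /K'; lra.
have y0K' : enorm y0 <= K' by rewrite /K'; lra.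
have ysK' : enorm ys <= K' by rewrite /K'; lra.
have [gyL _] := Lip x x y0 ys Dx xK' Dx xK' Dy0 y0K' Dys ysK'.
have hK : enorm (y0 - ys) <= K' by rewrite (le_trans (ler_enormB _ _)) // /K'; lra.
have bt_ge0 : 0 <= beta * t by rewrite mulr_ge0 // ltW.
have bt_le : beta * t <= beta * `|tmax|.
  by rewrite ler_wpM2l ?(ltW beta_gt0) // (le_trans t_le) // ler_norm.
have vi' : enorm d ^+ 2 <= enorm (y0 - ys) * enorm d + beta * t *
    (dot (gy x y0 - gy x ys) d + dot (gy x ys) d - dot (gy xs ys) d).
  have e1 : yt - (y0 + (beta * t) *: gy x y0) = d - (y0 - ys) - (beta * t) *: gy x y0.
    by apply/rowP => j; rewrite !mxE; ring.
  have e2 : ys - yt = - d by rewrite opprB.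
  have := ler_wpM2l bt_ge0 (Fs yt Dyt); rewrite -/d.
  move: vi; rewrite e1 e2 dotNr.
  have := dot_le_enorm (y0 - ys) d; rewrite sqr_enorm.
  move: (y0 - ys) => h; clearbody d; rewrite !dotE; lra.
have t1 : dot (gy x y0 - gy x ys) d <= L * K' * enorm d.
  rewrite (le_trans (dot_le_enorm _ _)) // ler_wpM2r // (le_trans gyL) //.
  by rewrite ler_wpM2l.
have t2 := gyC x yt Dx xK Dyt; rewrite -/d in t2.
have t3 : - dot (gy xs ys) d <= enorm (gy xs ys) * enorm d.
  by rewrite -dotNl -(enormN (gy xs ys)) dot_le_enorm.
have dPQ : enorm d ^+ 2 <= P * enorm d + Q.
  apply: (le_trans vi').
  have S_ge0 : 0 <= L * K' * enorm d + C * (1 + enorm d) + enorm (gy xs ys) * enorm d.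
    by rewrite !addr_ge0 ?mulr_ge0 ?addr_ge0.
  have s1 := ler_wpM2r d_ge0 hK.
  have s2 : beta * t * (dot (gy x y0 - gy x ys) d + dot (gy x ys) d - dot (gy xs ys) d)
    <= beta * `|tmax| * (L * K' * enorm d + C * (1 + enorm d) + enorm (gy xs ys) * enorm d).
    apply: (le_trans (ler_wpM2l bt_ge0 _) (ler_wpM2r S_ge0 bt_le)).
    by rewrite !lerD.
  by rewrite /P /Q; lra.
have P_ge0 : 0 <= P by rewrite !(addr_ge0, mulr_ge0) // ltW.
have Q_ge0 : 0 <= Q by rewrite !mulr_ge0 // ltW.
have : enorm yt <= enorm d + enorm ys by rewrite -{1}(subrK ys yt) ler_enormD.
nra.
Qed.

(** The threshold must not depend on [t0] or [delta], although [delta] multiplies |x - x0|^2 on the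
    right. Since t0 / tmax <= [delta], the factor [t0] on the left compensates for a small
    [delta]. *)
Lemma small_step_accepted (K xi omega beta nu tmax : R) :
  0 < xi -> 0 < omega -> 0 < beta -> 0 < nu -> 0 < tmax ->
  exists2 t1 : R, 0 < t1 & forall x x0 y y0 t t0 delta,
  D1 x -> enorm x <= K -> D1 x0 -> enorm x0 <= K ->
  D2 y -> enorm y <= K -> D2 y0 -> enorm y0 <= K ->
  0 < t <= t1 -> 0 < t0 <= tmax -> t0 / tmax <= delta ->
  t * t0 / xi * enorm (gx x y - gx x0 y0) ^+ 2
    + 2 * t * (Phi x y0 + dot (gy x y0) (y - y0) - Phi x y)
  <= nu * (omega * delta * enorm (x - x0) ^+ 2 + enorm (y - y0) ^+ 2 / beta).
Proof.
move=> xi_gt0 omega_gt0 beta_gt0 nu_gt0 tmax_gt0.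
have [L L_ge0 Lip] := lip K.
(* [a] comes from |theta|^2 <= 2 L^2 (X^2 + Y^2), and the extra 2 L in [b] from the concavity gap,
   which is at most L Y^2. *)
pose a := 2 * L ^+ 2 / xi * tmax; pose b := a + 2 * L.
have a_ge0 : 0 <= a by rewrite !mulr_ge0 ?invr_ge0 ?sqr_ge0 // ltW.
have b_ge0 : 0 <= b by rewrite addr_ge0 // mulr_ge0.
have b1_gt0 : 0 < b + 1 by rewrite ltr_wpDl.
pose t1 := Num.min (nu * omega / (b + 1)) (nu / beta / (b + 1)).
exists t1; first by rewrite lt_min !divr_gt0 ?mulr_gt0.
move=> x x0 y y0 t t0 delta Dx xK Dx0 x0K Dy yK Dy0 y0K /andP[t_gt0 t_le]
  /andP[t0_gt0 t0_le] delta_ge.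
have [gyL gxL] := Lip x x0 y y0 Dx xK Dx0 x0K Dy yK Dy0 y0K.
have [gyL' _] := Lip x x y y0 Dx xK Dx xK Dy yK Dy0 y0K.
set X := enorm (x - x0) in gxL *; set Y := enorm (y - y0) in gxL gyL gyL' *.
have X_ge0 : 0 <= X := enorm_ge0 _; have Y_ge0 : 0 <= Y := enorm_ge0 _.
have tb1 : t * (b + 1) <= nu * omega.
  by rewrite -ler_pdivlMr // (le_trans t_le) // ge_min lexx.
have tb2 : t * (b + 1) <= nu / beta.
  by rewrite -ler_pdivlMr // (le_trans t_le) // ge_min lexx orbT.
have PhiL : Phi x y0 + dot (gy x y0) (y - y0) - Phi x y <= L * Y ^+ 2.
  have := Phi_gy x y y0 Dx Dy Dy0.
  have -> : dot (gy x y) (y0 - y) = - dot (gy x y) (y - y0) by rewrite -dotNr opprB.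
  have : dot (gy x y - gy x y0) (- (y - y0)) <= L * Y ^+ 2.
    rewrite (le_trans (dot_le_enorm _ _)) // enormN -/Y expr2 mulrA.
    by rewrite ler_wpM2r.
  rewrite dotNr dotBl; lra.
have thL : enorm (gx x y - gx x0 y0) ^+ 2 <= 2 * L ^+ 2 * (X ^+ 2 + Y ^+ 2).
  have th_ge0 := enorm_ge0 (gx x y - gx x0 y0).
  apply: (@le_trans _ _ ((L * (X + Y)) ^+ 2)).
    by rewrite ler_pXn2r ?nnegrE ?mulr_ge0 ?addr_ge0.
  have := sqr_ge0 (L * (X - Y)); lra.
have h1 : t * t0 / xi * enorm (gx x y - gx x0 y0) ^+ 2 <=
    t * (t0 / tmax) * a * (X ^+ 2 + Y ^+ 2).
  have -> : t * (t0 / tmax) * a * (X ^+ 2 + Y ^+ 2) =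
     t * t0 / xi * (2 * L ^+ 2 * (X ^+ 2 + Y ^+ 2)).
    by rewrite /a; field; rewrite !gt_eqF.
  by rewrite ler_wpM2l // divr_ge0 ?mulr_ge0 // ltW.
have h2 : 2 * t * (Phi x y0 + dot (gy x y0) (y - y0) - Phi x y) <= 2 * t * (L * Y ^+ 2).
  by rewrite ler_wpM2l // mulr_ge0 // ltW.
set r := t0 / tmax in h1 delta_ge *.
have r_ge0 : 0 <= r by rewrite divr_ge0 // ltW.
have r_le1 : r <= 1 by rewrite ler_pdivrMr // mul1r.
have ta : t * a <= nu * omega.
  by rewrite (le_trans _ tb1) // ler_wpM2l ?(ltW t_gt0) // /b; lra.
have tb : t * b <= nu / beta.
  by rewrite (le_trans _ tb2) // ler_wpM2l ?(ltW t_gt0) //; lra.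
have X2_ge0 := sqr_ge0 X; have Y2_ge0 := sqr_ge0 Y.
have k1 : t * r * a * X ^+ 2 <= nu * omega * delta * X ^+ 2.
  by rewrite ler_wpM2r // mulrAC ler_pM // mulr_ge0 // ltW.
have k2 : t * r * a * Y ^+ 2 <= t * a * Y ^+ 2.
  by rewrite ler_wpM2r // mulrAC -[leRHS]mulr1 ler_wpM2l // mulr_ge0 // ltW.
have k3 : t * b * Y ^+ 2 <= nu / beta * Y ^+ 2 by rewrite ler_wpM2r.
have -> : nu * (omega * delta * X ^+ 2 + Y ^+ 2 / beta) =
   nu * omega * delta * X ^+ 2 + nu / beta * Y ^+ 2 by ring.
move: k3; rewrite /b; lra.
Qed.


(** * Descent of the potential, boundedness of the iterates and of the step sizes *)

Hypothesis gy_grad : forall x y, D1 x -> D2 y -> has_grad (Phi x) y (gy x y).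
Hypothesis F_convex : forall u v t, D2 u -> D2 v -> 0 <= t <= 1 ->
  F (t *: u + (1 - t) *: v) <= t * F u + (1 - t) * F v.
Hypothesis G_lsc : forall (u : 'rV[R]_q) (c C : R),
  (forall e : R, 0 < e <= 1 ->
    exists2 v, enorm (v - u) <= e & D1 v /\ G v <= c + C * e) ->
  D1 u /\ G u <= c.
Hypothesis F_lsc : forall (u : 'rV[R]_p) (c C : R),
  (forall e : R, 0 < e <= 1 ->
    exists2 v, enorm (v - u) <= e & D2 v /\ F v <= c + C * e) ->
  D2 u /\ F u <= c.

Variables (psi xi phi beta tmax nu mu eta : R) (M : nat).
Let omega := 2 * psi - xi - psi ^+ 3 * phi / (1 + psi).
Hypotheses (psi_gt1 : 1 < psi) (xi_gt0 : 0 < xi) (omega_gt0 : 0 < omega).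
Hypotheses (beta_gt0 : 0 < beta) (tmax_gt0 : 0 < tmax) (nu01 : 0 < nu < 1).
Hypotheses (mu_gt0 : 0 < mu) (eta01 : 0 <= eta < 1) (M_gt0 : (0 < M)%N).

Variables (x z : nat -> 'rV[R]_q) (y : nat -> 'rV[R]_p) (tau : nat -> R).
Hypothesis x_dom : forall n, D1 (x n).
Hypothesis y_dom : forall n, D2 (y n).
Hypothesis tau_bounds : forall n, 0 < tau n <= tmax.
Hypothesis tau_growth : forall n, tau n.+1 <= phi * tau n.
Hypothesis z_rec : forall n, z n.+1 = (psi - 1) / psi *: x n + psi^-1 *: z n.
Hypothesis x_vi : forall n w, D1 w ->
  tau n * (G (x n.+1) - G w) <=
  dot (x n.+1 - (z n.+1 - tau n *: gx (x n) (y n))) (w - x n.+1).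
Hypothesis y_vi : forall n w, D2 w ->
  beta * tau n.+1 * (F (y n.+1) - F w) <=
  dot (y n.+1 - (y n + (beta * tau n.+1) *: gy (x n.+1) (y n))) (w - y n.+1).
Hypothesis tau_ls : forall n,
  ls_cond Phi gx gy xi nu eta omega beta M x y tau n.+1 (tau n.+1) (y n.+1).
Hypothesis tau_backtrack : forall n, Num.min (tau n) tmax <= tau n.+1 \/
  exists t yt, [/\ tau n.+1 = mu * t, 0 < t <= tmax, D2 yt,
    forall w, D2 w -> beta * t * (F yt - F w) <=
      dot (yt - (y n + (beta * t) *: gy (x n.+1) (y n))) (w - yt) &
    ~ ls_cond Phi gx gy xi nu eta omega beta M x y tau n.+1 t yt].

Let r := r_seq omega beta x y tau.
Let P := psi / (psi - 1).

Let psi_gt0 : 0 < psi. Proof. exact: lt_trans psi_gt1. Qed.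
Let psi1_gt0 : 0 < psi - 1. Proof. by rewrite subr_gt0. Qed.
Let P_gt0 : 0 < P. Proof. exact: divr_gt0. Qed.
Let nu_gt0 : 0 < nu. Proof. by case/andP: nu01. Qed.
Let nu1_gt0 : 0 < 1 - nu. Proof. by rewrite subr_gt0; case/andP: nu01. Qed.
Let eta_ge0 : 0 <= eta. Proof. by case/andP: eta01. Qed.
Let eta1_gt0 : 0 < 1 - eta. Proof. by rewrite subr_gt0; case/andP: eta01. Qed.
Let tau_gt0 n : 0 < tau n. Proof. by case/andP: (tau_bounds n). Qed.

Lemma delta_seq_ge n : tau n / tmax <= delta_seq tau n.
Proof.
case: n => [|n] /=; first by rewrite ler_pdivrMr // mul1r; case/andP: (tau_bounds 0).
by rewrite ler_wpM2l ?(ltW (tau_gt0 _)) // lef_pV2 ?posrE //; case/andP: (tau_bounds n).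
Qed.

Lemma delta_seq_ge0 n : 0 <= delta_seq tau n.
Proof. by rewrite (le_trans _ (delta_seq_ge n)) // divr_ge0 // ltW. Qed.

Lemma r_seq_ge0 n : 0 <= r n.
Proof.
apply: addr_ge0; last by rewrite divr_ge0 ?sqr_ge0 // ltW.
exact: mulr_ge0 (mulr_ge0 (ltW omega_gt0) (delta_seq_ge0 _)) (sqr_ge0 _).
Qed.

Lemma c_seq_ge0 n : 0 <= c_seq omega beta eta M x y tau n.
Proof.
rewrite /c_seq; case: ifP => // _.
by rewrite mulr_ge0 ?divr_ge0 //; apply: sumr_ge0 => k _; exact: r_seq_ge0.
Qed.

Definition energy xs ys n : R :=
  P * enorm (z n.+2 - xs) ^+ 2 + enorm (y n - ys) ^+ 2 / beta
  + omega * delta_seq tau n * enorm (x n.+1 - x n) ^+ 2.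

Definition potential xs ys n : R :=
  energy xs ys n + (1 - nu) * window_weight eta M r n.+1.

(** The last term of the energy at [n] and the dual increment together form r_(n+1). The line search
    pays for nu r_(n+1) + (1 - nu) c_(n+1), which leaves a share 1 - nu of r_(n+1). *)
Lemma energy_step xs ys n : saddle_ineq xs ys ->
  energy xs ys n.+1 + (1 - nu) * r n.+1 <=
  energy xs ys n + (1 - nu) * c_seq omega beta eta M x y tau n.+1.
Proof.
move=> sad; have [Dxs Dys _ _] := sad.
have := primal_dual_step psi xi phi beta _ _ _ _ _ _ _ _ _ _ _ _ sad (x_dom n.+1)
  (y_dom n.+1) (y_dom n) psi_gt1 xi_gt0 beta_gt0 (tau_gt0 n.+1) (tau_gt0 n)
  (tau_growth n) (z_rec n.+1) (z_rec n.+2) (x_vi n.+1 _ Dxs)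
  (x_vi n _ (x_dom n.+2)) (y_vi n _ Dys).
have := tau_ls n; rewrite /ls_cond /energy /r /r_seq /= -/omega -/P /r_val /=.
lra.
Qed.

Lemma potential_step xs ys n : saddle_ineq xs ys -> (M <= n)%N ->
  potential xs ys n.+1 + (1 - nu) * (1 - eta) * r n.+1 <= potential xs ys n.
Proof.
move=> sad Mn; have := energy_step xs ys n sad.
rewrite /potential (window_weightS eta M r n.+1) // /c_seq ltnS leqNgt.
rewrite (leq_trans M_gt0 Mn) /=.
(* From M <= n on, the averaging window is full, with exactly [M] terms. *)
have -> : maxn (n.+1 - M) 1 = (n.+1 - M)%N.
  by apply/maxn_idPl; rewrite subn_gt0 ltnS.
rewrite (subKn (leqW Mn)).
rewrite -/r; lra.
Qed.

Lemma energy_ge0 xs ys n : 0 <= energy xs ys n.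
Proof.
apply: addr_ge0.
  by rewrite addr_ge0 ?divr_ge0 ?sqr_ge0 ?(ltW beta_gt0) // mulr_ge0 ?sqr_ge0 // ltW.
exact: mulr_ge0 (mulr_ge0 (ltW omega_gt0) (delta_seq_ge0 _)) (sqr_ge0 _).
Qed.

Lemma energy_le_potential xs ys n : energy xs ys n <= potential xs ys n.
Proof.
by rewrite lerDl mulr_ge0 ?(ltW nu1_gt0) // window_weight_ge0 //; exact: r_seq_ge0.
Qed.

Lemma potential_antimono xs ys m n : saddle_ineq xs ys -> (M <= m)%N -> (m <= n)%N ->
  potential xs ys n <= potential xs ys m.
Proof.
move=> sad Mm; elim: n => [|n IH]; first by rewrite leqn0 => /eqP->.
rewrite leq_eqVlt => /predU1P[->//|]; rewrite ltnS => mn.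
have := IH mn; have := potential_step xs ys n sad (leq_trans Mm mn).
have : 0 <= (1 - nu) * (1 - eta) * r n.+1.
  by rewrite !mulr_ge0 ?r_seq_ge0 // ltW.
lra.
Qed.

Lemma r_seq_small xs ys : saddle_ineq xs ys ->
  forall e : R, 0 < e -> exists N, forall n, (N <= n)%N -> r n <= e.
Proof.
move=> sad; apply: (descent_increment_small (potential xs ys) r ((1 - nu) * (1 - eta)) M).
- exact: mulr_gt0.
- by move=> n; rewrite (le_trans (energy_ge0 xs ys n)) ?energy_le_potential.
- exact: r_seq_ge0.
- by move=> n; exact: potential_step.
Qed.

Lemma iterates_bounded xs ys : saddle_ineq xs ys ->
  exists K, forall n, (M.+2 <= n)%N -> enorm (x n) <= K /\ enorm (y n) <= K.
Proof.
move=> sad; pose B := potential xs ys M.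
have B_ge0 : 0 <= B by rewrite (le_trans (energy_ge0 xs ys M)) ?energy_le_potential.
have sqr_le (s c : R) : 0 <= s -> s ^+ 2 <= c -> s <= c + 1 by nra.
have eB n : (M <= n)%N -> P * enorm (z n.+2 - xs) ^+ 2 + enorm (y n - ys) ^+ 2 / beta <= B.
  move=> Mn; apply: le_trans (potential_antimono xs ys M n sad (leqnn M) Mn).
  apply: le_trans (energy_le_potential _ _ _); rewrite lerDl.
  exact: mulr_ge0 (mulr_ge0 (ltW omega_gt0) (delta_seq_ge0 _)) (sqr_ge0 _).
have zB n : (M <= n)%N -> enorm (z n.+2) <= B / P + 1 + enorm xs.
  move=> Mn; have : enorm (z n.+2 - xs) ^+ 2 <= B / P.
    rewrite ler_pdivlMr // mulrC (le_trans _ (eB n Mn)) // lerDl.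
    by rewrite divr_ge0 ?sqr_ge0 // ltW.
  move=> /(sqr_le _ _ (enorm_ge0 _)).
  have : enorm (z n.+2) <= enorm (z n.+2 - xs) + enorm xs.
    by rewrite -{1}(subrK xs (z n.+2)) ler_enormD.
  lra.
have yB n : (M <= n)%N -> enorm (y n) <= B * beta + 1 + enorm ys.
  move=> Mn; have : enorm (y n - ys) ^+ 2 <= B * beta.
    rewrite -ler_pdivrMr // (le_trans _ (eB n Mn)) // lerDr.
    by rewrite mulr_ge0 ?sqr_ge0 // ltW.
  move=> /(sqr_le _ _ (enorm_ge0 _)).
  have : enorm (y n) <= enorm (y n - ys) + enorm ys.
    by rewrite -{1}(subrK ys (y n)) ler_enormD.
  lra.
pose Kz := B / P + 1 + enorm xs; pose Kx := P * Kz + (psi - 1)^-1 * Kz.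
exists (Num.max Kx (B * beta + 1 + enorm ys)) => n Mn; rewrite !le_max; split; last first.
  by rewrite yB ?orbT // (leq_trans _ Mn) // leqW.
apply/orP; left; case: n Mn => [//|[//|n]]; rewrite !ltnS => Mn.
(* The energy bounds only [z] and [y]; inverting the recursion of [z] recovers [x]. *)
have xE : x n.+2 = P *: z n.+3 - (psi - 1)^-1 *: z n.+2.
  rewrite (z_rec n.+2); apply/rowP => j; rewrite !mxE /P; field.
  by rewrite !gt_eqF.
rewrite xE (le_trans (ler_enormB _ _)) // !enormZ.
rewrite !ger0_norm ?invr_ge0 ?(ltW P_gt0) ?(ltW psi1_gt0) //.
by rewrite lerD // ler_wpM2l ?invr_ge0 ?(ltW P_gt0) ?(ltW psi1_gt0) ?zB // leqW.
Qed.

Lemma tau_lower_bound xs ys : saddle_ineq xs ys ->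
  exists2 tmin, 0 < tmin & forall n, (M.+2 <= n)%N -> tmin <= tau n.
Proof.
move=> sad; have [K xyK] := iterates_bounded xs ys sad.
have [C trialC] := trial_point_bounded K beta tmax xs ys sad beta_gt0.
have [Dxs Dys _ _] := sad.
have [t1 t1_gt0 acc] := small_step_accepted (Num.max K C) xi omega beta nu tmax
  xi_gt0 omega_gt0 beta_gt0 nu_gt0 tmax_gt0.
(* The starting value, the cap, and [mu] times the acceptance threshold, because a rejected trial
   step exceeds [t1]. *)
exists (Num.min (Num.min (tau M.+2) tmax) (mu * t1)).
  by rewrite !lt_min tau_gt0 tmax_gt0 mulr_gt0.
elim=> [//|n IH]; rewrite leq_eqVlt => /predU1P[<-|]; first by rewrite !ge_min lexx.
rewrite ltnS => Mn; have /= {}IH := IH Mn.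
have [tau_ge|[t [yt [-> t_bd Dyt vit nls]]]] := tau_backtrack n.
  by rewrite (le_trans _ tau_ge) // le_min IH !ge_min lexx !orbT.
rewrite ge_min; apply/orP; right; rewrite ler_pM2l // leNgt; apply/negP => tt1.
apply: nls; rewrite /ls_cond /=.
have [xK yK] := xyK n Mn; have [xK' _] := xyK n.+1 (leqW Mn).
have ytC : enorm yt <= C by exact: trialC (x_dom _) xK' (y_dom _) yK t_bd Dyt (vit _ Dys).
have t01 : 0 < t <= t1 by case/andP: t_bd => -> _; rewrite ltW.
apply: le_trans (acc (x n.+1) (x n) yt (y n) t (tau n) (delta_seq tau n) _ _ _ _ _ _ _ _
  t01 (tau_bounds n) (delta_seq_ge n)) _; rewrite ?le_max ?xK ?yK ?xK' ?ytC ?orbT //.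
(* Acceptance is obtained from nu r alone; the averaged term only relaxes the test. *)
by rewrite /r_val /= lerDl mulr_ge0 ?c_seq_ge0 // ltW.
Qed.

(** Small r_n controls the increments of [x] only up to the factor delta, now at least tmin / tmax.
    For x - z, the recursion x_(n+1) - z_(n+1) = (x_(n+1) - x_n) + (x_n - z_n) / psi is a
    contraction with vanishing perturbation. *)
Lemma increments_small xs ys : saddle_ineq xs ys -> forall e : R, 0 < e ->
  exists N, forall n, (N <= n)%N ->
    [/\ enorm (x n.+1 - x n) <= e, enorm (y n.+1 - y n) <= e & enorm (x n - z n) <= e].
Proof.
move=> sad; have [tmin tmin_gt0 tau_ge] := tau_lower_bound xs ys sad.
have dxy (e : R) : 0 < e -> exists N, forall n, (N <= n)%N ->
    enorm (x n.+1 - x n) <= e /\ enorm (y n.+1 - y n) <= e.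
  move=> e_gt0; pose a := omega * (tmin / tmax) * e ^+ 2.
  have a_gt0 : 0 < a by rewrite !mulr_gt0 ?invr_gt0 ?exprn_gt0.
  have b_gt0 : 0 < e ^+ 2 / beta by rewrite divr_gt0 ?exprn_gt0.
  have [|N rN] := r_seq_small xs ys sad (Num.min a (e ^+ 2 / beta)).
    by rewrite lt_min a_gt0 b_gt0.
  exists (maxn N M.+2) => n; rewrite geq_max => /andP[Nn Mn].
  have := rN n.+1 (leqW Nn); rewrite le_min /r /r_seq /r_val /= => /andP[ra rb].
  have od_gt0 : 0 < omega * (tmin / tmax) by rewrite !mulr_gt0 ?invr_gt0.
  have od_le : omega * (tmin / tmax) <= omega * delta_seq tau n.
    rewrite ler_wpM2l ?(ltW omega_gt0) // (le_trans _ (delta_seq_ge n)) //.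
    by rewrite ler_wpM2r ?invr_ge0 ?(ltW tmax_gt0) ?tau_ge.
  have x_ge0 := sqr_ge0 (enorm (x n.+1 - x n)).
  have y_ge0 : 0 <= enorm (y n.+1 - y n) ^+ 2 / beta by rewrite divr_ge0 ?sqr_ge0 // ltW.
  have od_x : 0 <= omega * delta_seq tau n * enorm (x n.+1 - x n) ^+ 2.
    exact: mulr_ge0 (mulr_ge0 (ltW omega_gt0) (delta_seq_ge0 _)) x_ge0.
  split; rewrite -(ler_pXn2r (n := 2)) ?nnegrE ?enorm_ge0 ?(ltW e_gt0) //.
    rewrite -(ler_pM2l od_gt0) -/a; have := ler_wpM2r x_ge0 od_le; lra.
  by rewrite -(ler_pM2r (x := beta^-1)) ?invr_gt0 //; lra.
have psi01 : 0 <= psi^-1 < 1.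
  by rewrite invr_ge0 invf_lt1 // psi_gt1 ltW.
have xz := contraction_small (fun n => enorm (x n - z n)) (fun n => enorm (x n.+1 - x n))
  psi^-1 0 psi01 (fun n => enorm_ge0 _).
move=> e e_gt0; have [N1 xyN] := dxy e e_gt0.
have [n _| |N2 xzN] := xz _ _ e e_gt0.
- have -> : x n.+1 - z n.+1 = (x n.+1 - x n) + psi^-1 *: (x n - z n).
    rewrite z_rec; apply/rowP => j; rewrite !mxE; field.
    by rewrite gt_eqF.
  rewrite (le_trans (ler_enormD _ _)) // lerD2l enormZ ger0_norm //.
  by case/andP: psi01.
- by move=> e' /dxy[N xyN']; exists N => n /xyN'[].
exists (maxn N1 N2) => n; rewrite geq_max => /andP[N1n N2n].
by have [dx dy] := xyN n N1n; split => //; exact: xzN.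
Qed.


(** * Cluster points are saddle points and limits *)

Section ClusterPoint.
Variables (xs xb : 'rV[R]_q) (ys yb : 'rV[R]_p).
Hypothesis sad : saddle_ineq xs ys.
Hypothesis cluster_xy : forall e : R, 0 < e -> forall N, exists n,
  [/\ (N <= n)%N, enorm (x n - xb) <= e & enorm (y n - yb) <= e].

Lemma cluster_near (e : R) N : 0 < e -> exists n, (N <= n)%N /\
  [/\ enorm (x n.+1 - xb) <= e, enorm (y n.+1 - yb) <= e,
      enorm (x n.+1 - x n) <= e, enorm (y n.+1 - y n) <= e &
      enorm (x n.+1 - z n.+1) <= e].
Proof.
move=> e_gt0; have [N1 inc] := increments_small xs ys sad e e_gt0.
(* The successor forces a positive index, so that the point near the cluster point is the output of
   a prox step. *)
have [[|n] [Nn xn yn]] := cluster_xy e e_gt0 (maxn N N1).+1; first by [].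
move: Nn; rewrite ltnS geq_max => /andP[Nn N1n].
have [dx dy _] := inc n N1n; have [_ _ xz] := inc n.+1 (leqW N1n).
by exists n.
Qed.

Let near_prev {n : nat} (u v w : 'rV[R]_n) (e : R) :
  enorm (u - w) <= e -> enorm (u - v) <= e -> enorm (v - w) <= 2 * e.
Proof.
move=> uw uv; have := ler_enorm_trans u v w; rewrite (enormB v u); lra.
Qed.

(* [y] minimises [F - Phi x] up to errors; since [gy] need not be continuous in
   [x], the gradient is traded for values of [Phi] by concavity. *)
Lemma y_almost_optimal (K L tmin e : R) n w :
  (forall x1 x2 y1 y2,
    D1 x1 -> enorm x1 <= K -> D1 x2 -> enorm x2 <= K ->
    D2 y1 -> enorm y1 <= K -> D2 y2 -> enorm y2 <= K ->
    enorm (gy x1 y1 - gy x1 y2) <= L * enorm (y1 - y2) /\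
    enorm (gx x1 y1 - gx x2 y2) <= L * (enorm (x1 - x2) + enorm (y1 - y2))) ->
  0 <= L -> 0 < tmin -> tmin <= tau n.+1 ->
  enorm (x n.+1) <= K -> enorm (y n) <= K -> enorm (y n.+1) <= K ->
  enorm (y n.+1 - y n) <= e -> 0 < e <= 1 -> D2 w ->
  F (y n.+1) <= F w + (enorm w + K) / (beta * tmin) * e
    + Phi (x n.+1) (y n.+1) - Phi (x n.+1) w + L * e.
Proof.
move=> Lip L_ge0 tmin_gt0 tmin_le xK y0K yK dye /andP[e_gt0 e_le1] Dw.
have [gyL _] := Lip _ _ _ _ (x_dom n.+1) xK (x_dom n.+1) xK (y_dom n) y0K (y_dom n.+1) yK.
have vi := y_vi n w Dw; set bt := beta * tau n.+1 in vi.
have bt_gt0 : 0 < bt by exact: mulr_gt0.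
have btmin_gt0 : 0 < beta * tmin by exact: mulr_gt0.
have btmin_le : beta * tmin <= bt by rewrite ler_pM2l.
set d := y n.+1 - y n in dye gyL *.
have d_ge0 := enorm_ge0 d.
have e1 : y n.+1 - (y n + bt *: gy (x n.+1) (y n)) = d - bt *: gy (x n.+1) (y n).
  by rewrite opprD addrA.
have K_ge0 : 0 <= K by rewrite (le_trans (enorm_ge0 _) xK).
have wK : enorm (w - y n.+1) <= enorm w + K.
  by rewrite (le_trans (ler_enormB _ _)) // lerD2l.
have t1 : dot d (w - y n.+1) <= e * (enorm w + K).
  by rewrite (le_trans (dot_le_enorm _ _)) // ler_pM ?enorm_ge0.
have t1' : dot d (w - y n.+1) / bt <= (enorm w + K) / (beta * tmin) * e.
  have A_ge0 : 0 <= e * (enorm w + K) by rewrite mulr_ge0 ?addr_ge0 ?enorm_ge0 // ltW.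
  apply: (@le_trans _ _ (e * (enorm w + K) / bt)).
    by rewrite ler_wpM2r // invr_ge0 ltW.
  rewrite [leRHS]mulrC mulrA ler_wpM2l //.
  by rewrite lef_pV2 ?posrE.
have vi' : F (y n.+1) - F w <= dot d (w - y n.+1) / bt - dot (gy (x n.+1) (y n)) (w - y n.+1).
  rewrite -(ler_pM2l bt_gt0) (le_trans vi) // e1 dotBl dotZl mulrBr.
  by rewrite [bt * (_ / bt)]mulrC divfK // gt_eqF.
(* [c1] and [c2] turn the pairing with [gy (x n.+1) (y n)] into a difference of values of [Phi], up
   to a change of [gy] in its second argument, which is Lipschitz. *)
have c1 := Phi_gy _ _ _ (x_dom n.+1) (y_dom n) Dw.
have c2 := Phi_gy _ _ _ (x_dom n.+1) (y_dom n.+1) (y_dom n).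
have c3 : dot (gy (x n.+1) (y n) - gy (x n.+1) (y n.+1)) d <= L * e.
  rewrite (le_trans (dot_le_enorm _ _)) //.
  have dL : enorm (gy (x n.+1) (y n) - gy (x n.+1) (y n.+1)) <= L * e.
    by rewrite (le_trans gyL) // enormB ler_wpM2l.
  by rewrite -[leRHS]mulr1 ler_pM ?enorm_ge0 // (le_trans dye).
have s1 : w - y n = (w - y n.+1) + d by rewrite /d addrA subrK.
have s2 : y n - y n.+1 = - d by rewrite /d opprB.
move: c1 c2 c3; rewrite s1 s2 dotDr dotNr dotBl; move: vi' t1'; lra.
Qed.

Lemma cluster_saddle : saddle_ineq xb yb.
Proof.
have [Dxs Dys _ _] := sad.
have [K0 xyK0] := iterates_bounded xs ys sad.
have [tmin tmin_gt0 tau_ge] := tau_lower_bound xs ys sad.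
pose K : R := `|K0| + 1 + enorm xb + enorm yb + enorm xs + enorm ys.
have K0_le : K0 <= `|K0| by exact: ler_norm.
have K0_ge0 : 0 <= `|K0| by [].
have xb_ge0 := enorm_ge0 xb; have yb_ge0 := enorm_ge0 yb.
have xs_ge0 := enorm_ge0 xs; have ys_ge0 := enorm_ge0 ys.
have xK n : (M.+2 <= n)%N -> enorm (x n) <= K.
  by move=> /xyK0[]; rewrite /K; lra.
have yK n : (M.+2 <= n)%N -> enorm (y n) <= K.
  by move=> /xyK0[_]; rewrite /K; lra.
have xsK : enorm xs <= K by rewrite /K; lra.
have ysK : enorm ys <= K by rewrite /K; lra.
have xbK : enorm xb <= K by rewrite /K; lra.
have ybK : enorm yb <= K by rewrite /K; lra.
have K_ge0 : 0 <= K by rewrite (le_trans xs_ge0).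
have [L L_ge0 Lip] := lip K.
have x_opt (e : R) n w : (M.+2 <= n)%N -> 0 < e -> enorm (x n.+1 - z n.+1) <= e -> D1 w ->
    G (x n.+1) <= G w + (enorm w + K) / tmin * e + dot (gx (x n) (y n)) (w - x n.+1).
  move=> Mn e_gt0 xze Dw; have vi := x_vi n w Dw; have tau_n := tau_gt0 n.
  have wK : enorm (w - x n.+1) <= enorm w + K.
    by rewrite (le_trans (ler_enormB _ _)) // lerD2l xK // leqW.
  have t1 : dot (x n.+1 - z n.+1) (w - x n.+1) <= e * (enorm w + K).
    by rewrite (le_trans (dot_le_enorm _ _)) // ler_pM ?enorm_ge0.
  have t1' : dot (x n.+1 - z n.+1) (w - x n.+1) / tau n <= (enorm w + K) / tmin * e.
    have A_ge0 : 0 <= e * (enorm w + K) by rewrite mulr_ge0 ?addr_ge0 ?enorm_ge0 // ltW.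
    apply: (@le_trans _ _ (e * (enorm w + K) / tau n)).
      by rewrite ler_wpM2r // invr_ge0 ltW.
    by rewrite [leRHS]mulrC mulrA ler_wpM2l // lef_pV2 ?posrE // tau_ge.
  have e1 : x n.+1 - (z n.+1 - tau n *: gx (x n) (y n)) =
      (x n.+1 - z n.+1) + tau n *: gx (x n) (y n) by rewrite opprB addrA addrAC.
  have vi' : G (x n.+1) - G w <=
      dot (x n.+1 - z n.+1) (w - x n.+1) / tau n + dot (gx (x n) (y n)) (w - x n.+1).
    rewrite -(ler_pM2l tau_n) (le_trans vi) // e1 dotDl dotZl mulrDr.
    by rewrite [tau n * (_ / tau n)]mulrC divfK // gt_eqF.
  move: vi' t1'; lra.
(* Comparison with [xs] bounds [G] along the iterates near [xb], and lower semicontinuity then puts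
   [xb] in the domain. *)
have Dxb : D1 xb.
  pose C := G xs + (enorm xs + K) / tmin + (enorm (gx xs ys) + L * (4 * K)) * (2 * K).
  suff [] : D1 xb /\ G xb <= C by [].
  apply: (G_lsc xb C 0) => e /andP[e_gt0 e_le1].
  have [n [Mn [xe _ _ _ xze]]] := cluster_near e M.+2 e_gt0.
  exists (x n.+1) => //; split => //; rewrite mul0r addr0.
  apply: (le_trans (x_opt e n xs Mn e_gt0 xze Dxs)); rewrite /C; apply: lerD.
    by rewrite lerD2l -[leRHS]mulr1 ler_wpM2l // divr_ge0 ?addr_ge0 // ltW.
  rewrite (le_trans (dot_le_enorm _ _)) // ler_pM ?enorm_ge0 //; last first.
    rewrite (le_trans (ler_enormB _ _)) //.
    by have := xK n.+1 (leqW Mn); lra.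
  have [_ gxL] := Lip _ _ _ _ (x_dom n) (xK n Mn) Dxs xsK (y_dom n) (yK n Mn) Dys ysK.
  have : enorm (gx (x n) (y n)) <= enorm (gx (x n) (y n) - gx xs ys) + enorm (gx xs ys).
    by rewrite -{1}(subrK (gx xs ys) (gx (x n) (y n))) ler_enormD.
  have xys : enorm (x n - xs) + enorm (y n - ys) <= 4 * K.
    have := ler_enormB (x n) xs; have := ler_enormB (y n) ys.
    have := xK n Mn; have := yK n Mn; lra.
  have := ler_wpM2l L_ge0 xys; lra.
(* Same argument with [ys], the difference of [Phi] values being bounded by [Phi_growth]. *)
have Dyb : D2 yb.
  have [C0 C0_ge0 growth] := Phi_growth K xs ys Dxs Dys.
  pose C := F ys + (enorm ys + K) / (beta * tmin) + C0 + L.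
  suff [] : D2 yb /\ F yb <= C by [].
  apply: (F_lsc yb C 0) => e e01; have /andP[e_gt0 e_le1] := e01.
  have [n [Mn [_ ye _ dye _]]] := cluster_near e M.+2 e_gt0.
  exists (y n.+1) => //; split => //; rewrite mul0r addr0.
  have := y_almost_optimal K L tmin e n ys Lip L_ge0 tmin_gt0 (tau_ge _ (leqW Mn))
    (xK _ (leqW Mn)) (yK _ Mn) (yK _ (leqW Mn)) dye e01 Dys.
  have := growth _ _ (x_dom n.+1) (xK _ (leqW Mn)) (y_dom n.+1) (yK _ (leqW Mn)).
  have := ler_wpM2l L_ge0 e_le1.
  have A_ge0 : 0 <= (enorm ys + K) / (beta * tmin).
    by rewrite divr_ge0 ?addr_ge0 ?mulr_ge0 // ltW.
  have := ler_wpM2l A_ge0 e_le1; rewrite /C; lra.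
split => // w Dw.
  suff [_] : D1 xb /\ G xb <= G w + dot (gx xb yb) (w - xb) by lra.
  apply: (G_lsc _ _ ((enorm w + K) / tmin + L * 4 * (enorm w + K) + enorm (gx xb yb))).
  move=> e /andP[e_gt0 e_le1].
  have [n [Mn [xe ye dxe dye xze]]] := cluster_near e M.+2 e_gt0.
  exists (x n.+1) => //; split => //.
  apply: (le_trans (x_opt e n w Mn e_gt0 xze Dw)).
  have [_ gxL] := Lip _ _ _ _ (x_dom n) (xK n Mn) Dxb xbK (y_dom n) (yK n Mn) Dyb ybK.
  have xyb : enorm (x n - xb) + enorm (y n - yb) <= 4 * e.
    have := near_prev _ _ _ _ xe dxe; have := near_prev _ _ _ _ ye dye; lra.
  have wK : enorm (w - x n.+1) <= enorm w + K.
    by rewrite (le_trans (ler_enormB _ _)) // lerD2l xK // leqW.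
  have h1 : dot (gx (x n) (y n) - gx xb yb) (w - x n.+1) <= L * (4 * e) * (enorm w + K).
    rewrite (le_trans (dot_le_enorm _ _)) // ler_pM ?enorm_ge0 //.
    by rewrite (le_trans gxL) // ler_wpM2l.
  have h2 : dot (gx xb yb) (xb - x n.+1) <= enorm (gx xb yb) * e.
    by rewrite (le_trans (dot_le_enorm _ _)) // enormB ler_wpM2l ?enorm_ge0.
  have h3 : dot (gx xb yb) (w - x n.+1) =
      dot (gx xb yb) (w - xb) + dot (gx xb yb) (xb - x n.+1).
    by rewrite -dotDr addrA subrK.
  move: h1; rewrite dotBl; lra.
(* The values of [Phi] at [x n.+1] are compared with those at [xb] by convexity: from below with the
   fixed gradient [gx xb v], from above with [gx] at the iterates, which is bounded. *)
have opt v : D2 v -> F yb <= F v + (Phi xb yb - Phi xb v).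
  move=> Dv; suff [] : D2 yb /\ F yb <= F v + (Phi xb yb - Phi xb v) by [].
  apply: (F_lsc _ _ ((enorm v + K) / (beta * tmin) + L + enorm (gy xb yb)
    + (enorm (gx xb yb) + 2 * L) + enorm (gx xb v))).
  move=> e e01; have /andP[e_gt0 e_le1] := e01.
  have [n [Mn [xe ye dxe dye _]]] := cluster_near e M.+2 e_gt0.
  exists (y n.+1) => //; split => //.
  have xnK := xK _ (leqW Mn); have ynK := yK _ (leqW Mn).
  have := y_almost_optimal K L tmin e n v Lip L_ge0 tmin_gt0 (tau_ge _ (leqW Mn))
    xnK (yK _ Mn) ynK dye e01 Dv.
  have [_ gxL] := Lip _ _ _ _ (x_dom n.+1) xnK Dxb xbK (y_dom n.+1) ynK Dyb ybK.
  have gxB : enorm (gx (x n.+1) (y n.+1)) <= enorm (gx xb yb) + 2 * L.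
    have : enorm (gx (x n.+1) (y n.+1)) <=
        enorm (gx (x n.+1) (y n.+1) - gx xb yb) + enorm (gx xb yb).
      by rewrite -{1}(subrK (gx xb yb) (gx (x n.+1) (y n.+1))) ler_enormD.
    have xy2 : enorm (x n.+1 - xb) + enorm (y n.+1 - yb) <= 2 by lra.
    have := ler_wpM2l L_ge0 xy2; lra.
  have := Phi_gx _ _ _ (x_dom n.+1) Dxb (y_dom n.+1).
  have -> : dot (gx (x n.+1) (y n.+1)) (xb - x n.+1) =
      - dot (gx (x n.+1) (y n.+1)) (x n.+1 - xb) by rewrite -dotNr opprB.
  have : dot (gx (x n.+1) (y n.+1)) (x n.+1 - xb) <= (enorm (gx xb yb) + 2 * L) * e.
    by rewrite (le_trans (dot_le_enorm _ _)) // ler_pM ?enorm_ge0.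
  have := Phi_gy _ _ _ Dxb Dyb (y_dom n.+1).
  have : dot (gy xb yb) (y n.+1 - yb) <= enorm (gy xb yb) * e.
    by rewrite (le_trans (dot_le_enorm _ _)) // ler_wpM2l ?enorm_ge0.
  have := Phi_gx _ _ _ Dxb (x_dom n.+1) Dv.
  have : - dot (gx xb v) (x n.+1 - xb) <= enorm (gx xb v) * e.
    by rewrite -dotNr (le_trans (dot_le_enorm _ _)) // enormN ler_wpM2l ?enorm_ge0.
  lra.
(* Applying [opt] on the segment from [yb] to [w] and letting t tend to 0 brings the gradient
   back. *)
suff : dot (gy xb yb) (w - yb) <= F w - F yb by lra.
apply: (has_grad_chord_le (Phi xb) _ _ _ _ (gy_grad xb yb Dxb Dyb)) => t /andP[t_gt0 t_le1].
have t01 : 0 <= t <= 1 by rewrite ltW.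
rewrite segment_combination; have := opt _ (D2_convex w yb t Dw Dyb t01).
have := F_convex w yb t Dw Dyb t01; lra.
Qed.

Lemma potential_cluster_small (e : R) : 0 < e ->
  exists N, forall n, (N <= n)%N -> potential xb yb n <= e.
Proof.
move=> e_gt0; have sadb := cluster_saddle.
(* One summand for each term of the potential: [z] and [y] are within 2 d, with square at most 4 d
   as d <= 1; the increment term is at most d and the window at most M d. *)
pose C := 4 * P + 4 / beta + 1 + M%:R.
have C_gt0 : 0 < C.
  have b_ge0 : 0 <= 4 / beta by rewrite divr_ge0 // ltW.
  rewrite /C; have := ler0n R M; have := P_gt0; lra.
pose d := Num.min 1 (e / C).
have d_gt0 : 0 < d by rewrite lt_min ltr01 divr_gt0.
have d_le1 : d <= 1 by rewrite ge_min lexx.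
have dC : C * d <= e by rewrite mulrC -ler_pdivlMr // ge_min lexx orbT.
have [N rN] := r_seq_small xs ys sad d d_gt0.
(* The index must exceed N by [M], because the window looks back over [M] values of [r]. *)
have [n [Nn [xe ye dxe dye xze]]] := cluster_near d (M + N) d_gt0.
have Mn : (M <= n)%N by rewrite (leq_trans _ Nn) // leq_addr.
exists n => k nk; rewrite (le_trans (potential_antimono xb yb n k sadb Mn nk)) //.
apply: le_trans dC; rewrite /potential /energy.
have zx : enorm (z n.+2 - xb) <= 2 * d.
  have -> : z n.+2 - xb = (x n.+1 - xb) - psi^-1 *: (x n.+1 - z n.+1).
    rewrite (z_rec n.+1); apply/rowP => j; rewrite !mxE; field.
    by rewrite gt_eqF.
  rewrite (le_trans (ler_enormB _ _)) // enormZ ger0_norm ?invr_ge0 ?(ltW psi_gt0) //.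
  have : psi^-1 * enorm (x n.+1 - z n.+1) <= 1 * d.
    by rewrite ler_pM ?enorm_ge0 ?invr_ge0 ?(ltW psi_gt0) // invf_le1 // ltW.
  lra.
have yx := near_prev _ _ _ _ ye dye.
have sq (s : R) : 0 <= s -> s <= 2 * d -> s ^+ 2 <= 4 * d by nra.
have b1 := ler_wpM2l (ltW P_gt0) (sq _ (enorm_ge0 _) zx).
have ib_ge0 : 0 <= beta^-1 by rewrite invr_ge0 ltW.
have b2 := ler_wpM2r ib_ge0 (sq _ (enorm_ge0 _) yx).
have b3 : omega * delta_seq tau n * enorm (x n.+1 - x n) ^+ 2 <= d.
  apply: le_trans (rN n.+1 _); last by rewrite (leq_trans _ (leqW Nn)) // leq_addl.
  by rewrite /r /r_seq /r_val /= lerDl divr_ge0 ?sqr_ge0 // ltW.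
have b4 : window_weight eta M r n.+1 <= M%:R * d.
  apply: window_weight_le => //; [|exact: ltW|].
    by rewrite eta_ge0 -subr_ge0 ltW.
  move=> k0 k0n; apply: rN; rewrite (leq_trans _ k0n) //.
  by rewrite leq_subRL ?(leq_trans Mn) // (leq_trans Nn).
have b5 : (1 - nu) * window_weight eta M r n.+1 <= 1 * (M%:R * d).
  rewrite ler_pM ?(ltW nu1_gt0) ?window_weight_ge0 //; last first.
    by rewrite gerBl ltW.
  exact: r_seq_ge0.
rewrite /C; move: b1 b2 b3 b5; lra.
Qed.

Lemma iterates_cvg_cluster : x @ \oo --> xb /\ y @ \oo --> yb.
Proof.
have small (e : R) : 0 < e -> exists N, forall n, (N <= n)%N ->
    enorm (z n.+2 - xb) <= e /\ enorm (y n - yb) <= e.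
  move=> e_gt0; pose d := Num.min (P * e ^+ 2) (e ^+ 2 / beta).
  have e2_gt0 : 0 < e ^+ 2 by rewrite exprn_gt0.
  have [|N potN] := potential_cluster_small d; first by rewrite lt_min divr_gt0 // mulr_gt0.
  exists N => n /potN; rewrite le_min => /andP[potP potb].
  have en := energy_le_potential xb yb n.
  have t1 := mulr_ge0 (ltW P_gt0) (sqr_ge0 (enorm (z n.+2 - xb))).
  have t2 : 0 <= enorm (y n - yb) ^+ 2 / beta by rewrite divr_ge0 ?sqr_ge0 // ltW.
  have t3 := mulr_ge0 (mulr_ge0 (ltW omega_gt0) (delta_seq_ge0 n))
    (sqr_ge0 (enorm (x n.+1 - x n))).
  move: en; rewrite /energy => en.
  split; rewrite -(ler_pXn2r (n := 2)) ?nnegrE ?enorm_ge0 ?(ltW e_gt0) //.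
    by rewrite -(ler_pM2l P_gt0); lra.
  by rewrite -(ler_pM2r (x := beta^-1)) ?invr_gt0 //; lra.
split; apply: cvg_enorm => e e_gt0; last first.
  by have [N yN] := small e e_gt0; exists N => n /yN[].
have e2_gt0 : 0 < e / 2 by rewrite divr_gt0.
have [N1 zN] := small _ e2_gt0; have [N2 inc] := increments_small xs ys sad _ e2_gt0.
exists (maxn N1 N2).+2 => -[//|[//|n]]; rewrite !ltnS geq_max => /andP[N1n N2n].
have [zn _] := zN n N1n; have [_ _ xz] := inc n.+2 (leqW (leqW N2n)).
have := ler_enorm_trans (z n.+2) (x n.+2) xb; lra.
Qed.

End ClusterPoint.

Lemma iterates_cvg_saddle xs ys : saddle_ineq xs ys ->
  exists xb yb, [/\ saddle_ineq xb yb, x @ \oo --> xb & y @ \oo --> yb].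
Proof.
move=> sad; have [K xyK] := iterates_bounded xs ys sad.
have [xb [yb cl]] := bounded_cluster_pair x y K M.+2 xyK.
exists xb, yb; have [] := iterates_cvg_cluster xs xb ys yb sad cl.
by split => //; exact: cluster_saddle sad cl.
Qed.

End ConvexConcave.

(** * Reduction of the extended-real setting to the real-valued one *)

Theorem theorem3p1 (R : realType) (p q : nat)
  (f : 'rV[R]_p -> \bar R) (g : 'rV[R]_q -> \bar R)
  (Phi : 'rV[R]_q -> 'rV[R]_p -> R)
  (gx : 'rV[R]_q -> 'rV[R]_p -> 'rV[R]_q) (gy : 'rV[R]_q -> 'rV[R]_p -> 'rV[R]_p)
  (psi xi phi tau_max nu mu eta beta : R) (M : nat)
  (x z : nat -> 'rV[R]_q) (y : nat -> 'rV[R]_p) (tau : nat -> R) (i : nat -> nat) :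
  (* standing setting *)
  proper_closed_convex f -> proper_closed_convex g ->
  {within [set xy : 'rV[R]_q * 'rV[R]_p | dom g xy.1 /\ dom (fconj f) xy.2],
     continuous (fun xy : 'rV[R]_q * 'rV[R]_p => Phi xy.1 xy.2)} ->
  (* (A1) *)
  (exists xs ys, saddle_set g (fconj f) gx gy xs ys) ->
  (forall xs ys, saddle_set g (fconj f) gx gy xs ys ->
     lagr g (fconj f) Phi xs ys \is a fin_num) ->
  (* (A2): convexity / concavity and differentiability *)
  (forall y0, dom (fconj f) y0 -> forall x1 x2 t, dom g x1 -> dom g x2 ->
     0 <= t <= 1 ->
     Phi (t *: x1 + (1 - t) *: x2) y0 <= t * Phi x1 y0 + (1 - t) * Phi x2 y0) ->
  (forall x0, dom g x0 -> forall y1 y2 t, dom (fconj f) y1 -> dom (fconj f) y2 ->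
     0 <= t <= 1 ->
     t * Phi x0 y1 + (1 - t) * Phi x0 y2 <= Phi x0 (t *: y1 + (1 - t) *: y2)) ->
  (forall x0 y0, dom g x0 -> dom (fconj f) y0 ->
     has_grad (fun u => Phi u y0) x0 (gx x0 y0) /\
     has_grad (fun v => Phi x0 v) y0 (gy x0 y0)) ->
  (* (A2): local Lipschitz conditions *)
  (forall (X : set 'rV[R]_q) (Y : set 'rV[R]_p), bounded_set X -> bounded_set Y ->
     exists Lyy Lxx Lxy : R, [/\ 0 <= Lyy, 0 <= Lxx, 0 < Lxy &
       forall x1 x2 y1 y2, (X `&` dom g) x1 -> (X `&` dom g) x2 ->
         (Y `&` dom (fconj f)) y1 -> (Y `&` dom (fconj f)) y2 ->
         enorm (gy x1 y1 - gy x1 y2) <= Lyy * enorm (y1 - y2) /\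
         enorm (gx x1 y1 - gx x2 y2) <= Lxx * enorm (x1 - x2) + Lxy * enorm (y1 - y2)]) ->
  (* parameters of PDAc-L *)
  1 < psi < 1 + Num.sqrt 3 -> 0 < xi -> 1 < phi ->
  0 < 2 * psi - xi - psi ^+ 3 * phi / (1 + psi) ->
  0 < tau_max -> 0 < nu < 1 -> 0 < mu < 1 -> 0 <= eta < 1 -> (1 <= M)%N ->
  0 < beta ->
  dom g (x 0%N) -> dom (fconj f) (y 0%N) -> 0 < tau 0%N <= tau_max ->
  (* the iterates generated by PDAc-L *)
  PDAcL_run g (fconj f) Phi gx gy psi xi phi tau_max nu mu eta beta M x z y tau i ->
  exists xs ys, saddle_set g (fconj f) gx gy xs ys /\
    x @ \oo --> xs /\ y @ \oo --> ys.
Proof.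
move=> [f_proper _ _] [[gN _] g_lsc g_conv] _ [xs0 [ys0 sad0]] _ Phi_conv Phi_conc
  grads lips psi_bd xi_gt0 phi_gt1 omega_gt0 tmax_gt0 nu01 mu01 eta01 M_gt0 beta_gt0
  x0_dom y0_dom tau0_bd [_ run].
have mu_gt0 : 0 < mu by case/andP: mu01.
have mu_le1 : mu <= 1 by rewrite ltW //; case/andP: mu01.
have psi_gt1 : 1 < psi by case/andP: psi_bd.
set fs := fconj f in sad0 Phi_conv Phi_conc grads lips y0_dom run *.
have fsN v : fs v != -oo%E by exact: fconjNy.
have fs_conv : convex_efun fs by exact: fconj_convex.
have fs_lsc : lower_semicontinuous fs by exact: fconj_lsc.
have step_gt0 t j : 0 < t -> 0 < Num.min (phi * t) tau_max * mu ^+ j.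
  move=> t_gt0; rewrite mulr_gt0 ?exprn_gt0 // lt_min tmax_gt0 andbT.
  by rewrite mulr_gt0 // (lt_trans _ phi_gt1).
have step_le t j : 0 < t ->
    Num.min (phi * t) tau_max * mu ^+ j <= Num.min (phi * t) tau_max.
  move=> t_gt0; rewrite ler_piMr ?exprn_ile1 ?(ltW mu_gt0) // ltW //.
  by have := step_gt0 t 0%N t_gt0; rewrite expr0 mulr1.
have tau_bounds n : 0 < tau n <= tau_max.
  elim: n => [//|n /andP[tau_n _]]; have [_ _ [-> _ _ _]] := run n.+1 (ltn0Sn n).
  by rewrite step_gt0 // (le_trans (step_le _ _ tau_n)) // ge_min lexx orbT.
have tau_gt0 n : 0 < tau n by case/andP: (tau_bounds n).
have x_step n w : dom g w -> dom g (x n.+1) /\ tau n * (fine (g (x n.+1)) - fine (g w)) <=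
    dot (x n.+1 - (z n.+1 - tau n *: gx (x n) (y n))) (w - x n.+1).
  have [_ px _] := run n.+1 (ltn0Sn n).
  exact: (is_prox_vi _ _ _ _ gN g_conv (tau_gt0 n) px).
have bt_gt0 t : 0 < t -> 0 < beta * t by move=> t_gt0; exact: mulr_gt0.
have y_step n w : dom fs w ->
    dom fs (y n.+1) /\ beta * tau n.+1 * (fine (fs (y n.+1)) - fine (fs w)) <=
    dot (y n.+1 - (y n + (beta * tau n.+1) *: gy (x n.+1) (y n))) (w - y n.+1).
  have [_ _ [_ py _ _]] := run n.+1 (ltn0Sn n).
  exact: (is_prox_vi _ _ _ _ fsN fs_conv (bt_gt0 _ (tau_gt0 n.+1)) py).
have x_dom n : dom g (x n) by case: n => [//|n]; case: (x_step n _ x0_dom).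
have y_dom n : dom fs (y n) by case: n => [//|n]; case: (y_step n _ y0_dom).
have tau_growth n : tau n.+1 <= phi * tau n.
  have [_ _ [-> _ _ _]] := run n.+1 (ltn0Sn n).
  by rewrite (le_trans (step_le _ _ (tau_gt0 n))) // ge_min lexx.
(* With no reduction, phi > 1 keeps the step from shrinking below the smaller of its old value and
   the cap; otherwise [t] is the last rejected trial size. *)
have backtrack n : Num.min (tau n) tau_max <= tau n.+1 \/
  exists t yt, [/\ tau n.+1 = mu * t, 0 < t <= tau_max, dom fs yt,
    forall w, dom fs w -> beta * t * (fine (fs yt) - fine (fs w)) <=
      dot (yt - (y n + (beta * t) *: gy (x n.+1) (y n))) (w - yt) &
    ~ ls_cond Phi gx gy xi nu eta (2 * psi - xi - psi ^+ 3 * phi / (1 + psi)) beta M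
        x y tau n.+1 t yt].
  have [_ _ [tauE _ _]] := run n.+1 (ltn0Sn n); rewrite tauE.
  case: (i n.+1) => [|j] rejected; [left|right].
    rewrite expr0 mulr1 le_min !ge_min lexx orbT andbT.
    by rewrite ler_peMl ?(ltW phi_gt1) // ltW.
  set t := Num.min (phi * tau n) tau_max * mu ^+ j.
  have t_gt0 : 0 < t by exact: step_gt0.
  (* A rejection quantifies over all prox points of the trial step, so one must exist to give a
     point violating the test. *)
  have [b [c fs_ge]] := proper_fun_affine_minorant _ f_proper.
  have [yt pyt] := prox_exists fs _ _ (y n + (beta * t) *: gy (x n.+1) (y n)) _ _
    fs_lsc fs_ge y0_dom (bt_gt0 t t_gt0).
  have yt_vi := is_prox_vi _ _ _ _ fsN fs_conv (bt_gt0 t t_gt0) pyt.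
  exists t, yt; split.
  - by rewrite exprS mulrCA.
  - by rewrite t_gt0 (le_trans (step_le _ _ (tau_gt0 n))) // ge_min lexx orbT.
  - by have [] := yt_vi _ y0_dom.
  - by move=> w /yt_vi[].
  - exact: rejected j (ltnSn j) yt pyt.
have Phi_gx a b v : dom g a -> dom g b -> dom fs v ->
    Phi a v + dot (gx a v) (b - a) <= Phi b v.
  move=> ga gb fv; rewrite -lerBrDl; have [grad_x _] := grads a v ga fv.
  apply: (has_grad_chord_le _ _ _ _ _ grad_x) => t /andP[t_gt0 t_le1].
  have t01 : 0 <= t <= 1 by rewrite ltW.
  by rewrite segment_combination; have := Phi_conv v fv b a t gb ga t01; lra.
have Phi_gy u a b : dom g u -> dom fs a -> dom fs b ->
    Phi u b <= Phi u a + dot (gy u a) (b - a).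
  move=> gu fa fb; rewrite -lerBlDl -lerN2 -dotNl.
  have [_ grad_y] := grads u a gu fa.
  apply: (has_grad_chord_le _ _ _ _ _ (has_gradN _ _ _ grad_y)) => t /andP[t_gt0 t_le1].
  have t01 : 0 <= t <= 1 by rewrite ltW.
  by rewrite segment_combination; have := Phi_conc u gu b a t fb fa t01; lra.
have lip (K : R) : exists2 L : R, 0 <= L & forall x1 x2 y1 y2,
    dom g x1 -> enorm x1 <= K -> dom g x2 -> enorm x2 <= K ->
    dom fs y1 -> enorm y1 <= K -> dom fs y2 -> enorm y2 <= K ->
    enorm (gy x1 y1 - gy x1 y2) <= L * enorm (y1 - y2) /\
    enorm (gx x1 y1 - gx x2 y2) <= L * (enorm (x1 - x2) + enorm (y1 - y2)).
  have [Lyy [Lxx [Lxy [Lyy_ge0 Lxx_ge0 Lxy_gt0 Lip]]]] :=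
    lips _ _ (enorm_bounded_set K) (enorm_bounded_set K).
  exists (Lyy + Lxx + Lxy); first by rewrite !addr_ge0 // ltW.
  move=> x1 x2 y1 y2 gx1 x1K gx2 x2K fy1 y1K fy2 y2K.
  have [gyL gxL] := Lip x1 x2 y1 y2 (conj x1K gx1) (conj x2K gx2)
    (conj y1K fy1) (conj y2K fy2).
  have dx_ge0 := enorm_ge0 (x1 - x2); have dy_ge0 := enorm_ge0 (y1 - y2).
  split; first by rewrite (le_trans gyL) // ler_wpM2r //; lra.
  rewrite (le_trans gxL) // mulrDr lerD // ler_wpM2r //; lra.
have saddleE xs ys : saddle_set g fs gx gy xs ys <->
    saddle_ineq (dom g) (dom fs) (fine \o g) (fine \o fs) gx gy xs ys.
  split=> [[gxs fys /(subdiff_dom _ _ _ gN)[_ sx] /(subdiff_dom _ _ _ fsN)[_ sy]]|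
      [gxs fys sx sy]]; split => //.
  - by move=> w /sx; rewrite dotNl.
  - by apply/(subdiff_dom _ _ _ gN); split => // w /sx; rewrite dotNl.
  - by apply/(subdiff_dom _ _ _ fsN).
have [xb [yb [sad xb_lim yb_lim]]] := iterates_cvg_saddle (dom g) (dom fs) (fine \o g)
  (fine \o fs) Phi gx gy Phi_gx Phi_gy lip
  (fun u v t fu fv t01 => (convex_efun_fine fs fsN fs_conv u v t fu fv t01).1)
  (fun u v gu fv => (grads u v gu fv).2)
  (fun u v t fu fv t01 => (convex_efun_fine fs fsN fs_conv u v t fu fv t01).2)
  (fun u c C => fine_lower_semicontinuous_le g u c C gN g_lsc)
  (fun u c C => fine_lower_semicontinuous_le fs u c C fsN fs_lsc)
  psi xi phi beta tau_max nu mu eta M psi_gt1 xi_gt0 omega_gt0 beta_gt0 tmax_gt0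
  nu01 mu_gt0 eta01 M_gt0 x z y tau x_dom y_dom tau_bounds tau_growth
  (fun n => let: And3 zE _ _ := run n.+1 (ltn0Sn n) in zE)
  (fun n w gw => (x_step n w gw).2) (fun n w fw => (y_step n w fw).2)
  (fun n => let: And3 _ _ (And4 _ _ ls _) := run n.+1 (ltn0Sn n) in ls)
  backtrack xs0 ys0 ((saddleE xs0 ys0).1 sad0).
by exists xb, yb; split; first exact/saddleE.
Qed.
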